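(* Let $m>n$ and let $\Sigma$ be an $n$-dimensional complete (without boundary) self-shrinker properly immersed in $\mathbb{R}^m$. If $\Sigma\subset\overline{E^m(\sqrt{2n})}$ or $\Sigma\subset\overline{B^m(\sqrt{2n})}$, then $\Sigma$ is compact and $\Sigma\subset S^{m-1}(\sqrt{2n})$, i.e. $\Sigma$ is a minimal submanifold of $S^{m-1}(\sqrt{2n})$. Moreover, if $n=m-1$, then $\Sigma=S^n(\sqrt{2n})$.
   Context: An $n$-dimensional submanifold $\Sigma$ immersed in $\mathbb{R}^m$, $m>n$, is called a self-shrinker if $\mathbf{H}=-\frac12 X^N$, where $X$ is the position vector, $X^N$ is the component of $X$ normal to $\Sigma$, and $\mathbf{H}=\sum_{i=1}^n(\nabla_{E_i}E_i)^N$ is the mean curvature vector ($\{E_i\}$ a local orthonormal tangent frame of $\Sigma$, $\nabla$ the Euclidean connection), i.e. the trace of the second fundamental form. Inclusions and equalities of $\Sigma$ with subsets of $\mathbb{R}^m$ refer to the image of the immersion. Notation: $B^m(R)\subset\mathbb{R}^m$ is the (open) ball of radius $R$ centered at the origin, $\overline{A}$ is the closure of $A$, $E^m(R)=\mathbb{R}^m-\overline{B^m(R)}$, and $S^{m-1}(R)\subset\mathbb{R}^m$ is the $(m-1)$-dimensional sphere of radius $R$ centered at the origin. *)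

(* Defs.v *)
From HB Require Import structures.
From mathcomp Require Import all_boot all_order all_algebra.
From mathcomp Require Import all_classical all_reals all_analysis.
Set Implicit Arguments.
Unset Strict Implicit.
Unset Printing Implicit Defensive.
Import Order.TTheory GRing.Theory Num.Theory.
Import numFieldNormedType.Exports.

Local Open Scope classical_set_scope.
Local Open Scope ring_scope.

(* The library norm on 'rV[R]_m is the sup norm; the Euclidean structure is    *)
(* therefore introduced separately (both norms induce the same topology).      *)
Definition dotp {R : realType} {m : nat} (x y : 'rV[R]_m) : R :=
  \sum_(i < m) x 0 i * y 0 i.

Definition enorm {R : realType} {m : nat} (x : 'rV[R]_m) : R :=
  Num.sqrt (dotp x x).

Definition eball {R : realType} (m : nat) (r : R) : set 'rV[R]_m :=
  [set x | enorm x < r].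
Arguments eball {R} m r.

Definition eexterior {R : realType} (m : nat) (r : R) : set 'rV[R]_m :=
  ~` closure (eball m r).
Arguments eexterior {R} m r.

Definition esphere {R : realType} (m : nat) (r : R) : set 'rV[R]_m :=
  [set x | enorm x = r].
Arguments esphere {R} m r.

(* The component of w orthogonal to the linear subspace T of R^m: the unique   *)
(* z orthogonal to T such that w - z belongs to T.                             *)
Definition normal_part {R : realType} {m : nat} (T : set 'rV[R]_m)
    (w : 'rV[R]_m) : 'rV[R]_m :=
  xget 0 [set z | (forall t, T t -> dotp z t = 0) /\ T (w - z)].

Definition tangent_part {R : realType} {m : nat} (T : set 'rV[R]_m)
    (w : 'rV[R]_m) : 'rV[R]_m :=
  w - normal_part T w.

Fixpoint Ck_on {R : realType} {V W : normedModType R} (k : nat) (U : set V)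
    (f : V -> W) : Prop :=
  match k with
  | 0%N => forall x, U x -> {for x, continuous f}
  | k'.+1 => (forall x, U x -> differentiable f x) /\
             (forall v : V, Ck_on k' U ('D_v f))
  end.

(* C^infinity on the open set U *)
Definition smooth_on {R : realType} {V W : normedModType R} (U : set V)
    (f : V -> W) : Prop :=
  forall k, Ck_on k U f.

(* A homeomorphism from an open subset of M onto an open subset of R^n, given  *)
(* with its inverse; both functions are total, with arbitrary values outside   *)
(* chart_dom and chart_cod.                                                    *)
Record chart (R : realType) (n : nat) (M : topologicalType) := Chart {
  chart_dom : set M;
  chart_cod : set 'rV[R]_n;
  chart_map : M -> 'rV[R]_n;
  chart_inv : 'rV[R]_n -> M;
  chart_dom_open : open chart_dom;
  chart_cod_open : open chart_cod;
  chart_map_cod : forall p, chart_dom p -> chart_cod (chart_map p);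
  chart_inv_dom : forall u, chart_cod u -> chart_dom (chart_inv u);
  chart_mapK : forall p, chart_dom p -> chart_inv (chart_map p) = p;
  chart_invK : forall u, chart_cod u -> chart_map (chart_inv u) = u;
  chart_map_continuous : {within chart_dom, continuous chart_map};
  chart_inv_continuous : {within chart_cod, continuous chart_inv} }.

(* Smooth n-manifolds without boundary, not assumed connected. *)
Record smoothManifold (R : realType) (n : nat) := SmoothManifold {
  carrier :> topologicalType;
  carrier_hausdorff : hausdorff_space carrier;
  carrier_second_countable : @second_countable carrier;
  atlas : set (chart R n carrier);
  atlas_cover : forall p : carrier, exists2 c, atlas c & chart_dom c p;
  atlas_compatible : forall c d, atlas c -> atlas d ->
    smooth_on (chart_cod c `&` chart_inv c @^-1` chart_dom d)
              (chart_map d \o chart_inv c) }.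

Definition immersion {R : realType} {n m : nat} {M : smoothManifold R n}
    (X : M -> 'rV[R]_m) : Prop :=
  forall c, atlas c ->
    smooth_on (chart_cod c) (X \o chart_inv c) /\
    (forall u, chart_cod c u -> injective ('d (X \o chart_inv c) u)).

Definition proper_map {S T : topologicalType} (f : S -> T) : Prop :=
  continuous f /\ (forall K, compact K -> compact (f @^-1` K)).

Definition smooth_curve {R : realType} {n : nat} {M : smoothManifold R n}
    (g : R -> M) : Prop :=
  continuous g /\
  (forall c, atlas c ->
     smooth_on (V := R^o) (g @^-1` chart_dom c) (chart_map c \o g)).

(* Length of g on [0, 1] for the metric induced by X. *)
Definition curve_length {R : realType} {n m : nat} {M : smoothManifold R n}
    (X : M -> 'rV[R]_m) (g : R -> M) : \bar R :=
  (\int[lebesgue_measure]_(t in `[0%R, 1%R]) (enorm (derive1 (X \o g) t))%:E)%E.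

(* Riemannian distance of the induced metric, +oo between distinct components. *)
(* A piecewise smooth curve can be reparametrized, without changing its        *)
(* length, into a smooth one defined on R by stopping at corners and ends.     *)
Definition induced_dist {R : realType} {n m : nat} {M : smoothManifold R n}
    (X : M -> 'rV[R]_m) (p q : M) : \bar R :=
  ereal_inf [set l | exists g : R -> M,
    [/\ smooth_curve g, g 0 = p, g 1 = q & l = curve_length X g]].

Definition complete_immersion {R : realType} {n m : nat}
    {M : smoothManifold R n} (X : M -> 'rV[R]_m) : Prop :=
  forall x : nat -> M,
    (forall e : R, 0 < e -> exists N, forall i j, (N <= i)%N -> (N <= j)%N ->
       (induced_dist X (x i) (x j) < e%:E)%E) ->
    exists p, (fun i => induced_dist X (x i) p) @ \oo --> 0%E.

Definition tangent_space {R : realType} {n m : nat} {M : smoothManifold R n}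
    (X : M -> 'rV[R]_m) (p : M) : set 'rV[R]_m :=
  [set w | exists c, [/\ atlas c, chart_dom c p &
     range ('d (X \o chart_inv c) (chart_map c p)) w]].

(* Tangent vector field along F whose coordinate expression is e. *)
Definition push_field {R : realType} {n m : nat} (F : 'rV[R]_n -> 'rV[R]_m)
    (e : 'rV[R]_n -> 'rV[R]_n) (u : 'rV[R]_n) : 'rV[R]_m :=
  'd F u (e u).

Definition orthonormal_frame {R : realType} {n m : nat}
    (F : 'rV[R]_n -> 'rV[R]_m) (W : set 'rV[R]_n)
    (e : 'I_n -> 'rV[R]_n -> 'rV[R]_n) : Prop :=
  (forall i, smooth_on W (e i)) /\
  (forall u, W u -> forall i j,
     dotp (push_field F (e i) u) (push_field F (e j) u) = (i == j)%:R).

(* h = sum_i (P (D_{E_i} E_i))^N at p, for a local orthonormal tangent frame   *)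
(* E_i = dF(e_i) near p, where F is X in the chart c and D is the flat         *)
(* connection of R^m. Taking P = id gives the mean curvature vector in R^m;    *)
(* taking for P the projection onto the tangent space of a submanifold S       *)
(* containing the image of X gives the Levi-Civita connection of S, hence the  *)
(* mean curvature vector in S. The sum depends neither on the frame nor on     *)
(* the chart, so this determines h.                                            *)
Definition mean_curvature_wrt {R : realType} {n m : nat}
    {M : smoothManifold R n} (P : 'rV[R]_m -> 'rV[R]_m)
    (X : M -> 'rV[R]_m) (p : M) (h : 'rV[R]_m) : Prop :=
  forall c, atlas c -> chart_dom c p ->
    let F := X \o chart_inv c in
    let u := chart_map c p in
    exists (W : set 'rV[R]_n) (e : 'I_n -> 'rV[R]_n -> 'rV[R]_n),
      [/\ open W, W u, W `<=` chart_cod c, orthonormal_frame F W e &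
        h = \sum_(i < n) normal_part (tangent_space X p)
                           (P ('d (push_field F (e i)) u (e i u)))].

Definition is_mean_curvature {R : realType} {n m : nat}
    {M : smoothManifold R n} (X : M -> 'rV[R]_m) (p : M) (h : 'rV[R]_m) :=
  mean_curvature_wrt id X p h.

Definition self_shrinker {R : realType} {n m : nat} {M : smoothManifold R n}
    (X : M -> 'rV[R]_m) : Prop :=
  forall p, is_mean_curvature X p
    (- 2^-1 *: normal_part (tangent_space X p) (X p)).

Definition sphere_tangent {R : realType} {m : nat} (x : 'rV[R]_m) :
    set 'rV[R]_m :=
  [set t | dotp t x = 0].

Definition minimal_in_sphere {R : realType} {n m : nat}
    {M : smoothManifold R n} (r : R) (X : M -> 'rV[R]_m) : Prop :=
  range X `<=` esphere m r /\
  (forall p,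
     mean_curvature_wrt (tangent_part (sphere_tangent (X p))) X p 0).

(* Main.v *)
From HB Require Import structures.
Require Import Defs.
From mathcomp Require Import all_boot all_order all_algebra.
From mathcomp Require Import all_classical all_reals all_analysis.
From mathcomp Require Import ring lra.
Import Order.TTheory GRing.Theory Num.Theory.
Import numFieldNormedType.Exports.
Local Open Scope classical_set_scope.
Local Open Scope ring_scope.

Set Implicit Arguments.
Unset Strict Implicit.
Unset Printing Implicit Defensive.

(** Write [f] for the squared norm [|X|^2]. On a self-shrinker, the drift
    Laplacian [L g = Delta g - <X, grad g> / 2] has a simple expression on
    functions of [X]: the equation [H = - X^N / 2] says that every coordinate
    satisfies [L X_k = - X_k / 2], and the squared gradients of the coordinates
    add up to [n], so that [L f = 2n - f]. Let [u = f - 2n] when [X] stays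
    outside the sphere of radius [sqrt (2n)], and [u = 2n - f] when it stays
    inside. In both cases [u >= 0] and [L u = - u].

    The strong minimum principle for [L u <= 0] makes the zero set of [u] open.
    The set where [u] is positive is therefore closed as well as open, and the
    sublevel sets of [u] are compact because [X] is proper. If [u] were positive
    somewhere, it would have a smallest positive value, attained at a local
    minimum of [u]; but [L u >= 0] at a local minimum, against [L u = - u < 0].
    Hence [f = 2n] everywhere ([defect_eq0]), on all components at once, and the
    manifold is the preimage of a compact ball.

    The operator [L] is handled pointwise in a chart, as [drift_laplacian e b]:
    second derivatives along vectors [e i] with orthonormal images, minus a
    first derivative along [b]. The mean curvature equation provides such [e]
    and [b] at each point ([exists_adapted]); the tangential part of the
    derivatives of the frame goes into [b]. Nothing is known of how [e] and [b]
    vary with the point, so the proof of the strong minimum principle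
    ([no_interior_touching], [strong_minimum_principle]) builds its barrier from
    a quadratic function [q] of [X], for which [L q] and the squared gradient are
    bounded by Euclidean quantities.

    Once the image lies in the sphere, [X] is normal to it, and subtracting from
    [H] its component along [X] leaves zero: the immersion is minimal
    ([shrinker_sphere_minimal]). In codimension one, let [s] be a point of the
    sphere and [p] a point where [<X, s>] is largest. Then [s] is orthogonal to
    the tangent space at [p], hence a multiple of [X p]; and
    [L <X, s> = - <X, s> / 2] at a maximum forces [<X p, s> >= 0], so that
    [s = X p] ([shrinker_hypersurface_onto]). *)

(** * Second derivatives and the drift Laplacian *)

(** Locked, so that comparing iterated derivatives never unfolds them to
    limits. *)
HB.lock Definition pderive {R : realType} {V : normedModType R} (v : V)
  (f : V -> R) (x : V) : R := 'D_v f x.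

(** Second derivatives are taken along directions, because [derivable] passes
    directly from a function to one that agrees with it near [x], as the proofs
    of the sum and product rules require. *)
Definition twice_differentiable {R : realType} {V : normedModType R}
    (f : V -> R) (x : V) : Prop :=
  (\forall y \near x, differentiable f y) /\
  (forall v w, derivable (pderive v f) x w).

Section TwiceDifferentiable.
Context {R : realType} {V : normedModType R}.
Implicit Types (f g : V -> R) (x v : V).

Lemma pderive_cst (a : R) v : pderive v (cst a : V -> R) = cst 0.
Proof. by apply/funext => x; rewrite pderive.unlock derive_cst. Qed.

Lemma pderiveD f g x v : derivable f x v -> derivable g x v ->
  pderive v (f + g) x = pderive v f x + pderive v g x.
Proof. by move=> df dg; rewrite pderive.unlock (deriveD df dg). Qed.

Lemma pderiveM f g x v : derivable f x v -> derivable g x v ->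
  pderive v (f * g) x = f x * pderive v g x + g x * pderive v f x.
Proof. by move=> df dg; rewrite pderive.unlock (deriveM df dg). Qed.

Lemma near_eq_pderive f g x v :
  (\forall y \near x, f y = g y) -> pderive v f x = pderive v g x.
Proof. by move=> fg; rewrite pderive.unlock (near_eq_derive _ fg). Qed.

Lemma twice_differentiable1 f x :
  twice_differentiable f x -> differentiable f x.
Proof. by case=> /nbhs_singleton. Qed.

Lemma twice_differentiable_derivable f x v :
  twice_differentiable f x -> derivable f x v.
Proof. by move=> /twice_differentiable1; exact: diff_derivable. Qed.

Lemma twice_differentiable_cst (a : R) x : twice_differentiable (cst a) x.
Proof.
split; first by near=> y; exact: differentiable_cst.
by move=> v w; rewrite pderive_cst; exact: derivable_cst.
Unshelve. all: by end_near. Qed.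

Lemma near_pderiveD f g x v :
  twice_differentiable f x -> twice_differentiable g x ->
  \forall y \near x, (pderive v f + pderive v g) y = pderive v (f + g) y.
Proof.
move=> [df _] [dg _]; near=> y.
have dfy : differentiable f y by near: y.
have dgy : differentiable g y by near: y.
by rewrite pderiveD//; exact: diff_derivable.
Unshelve. all: by end_near. Qed.

Lemma near_pderiveM f g x v :
  twice_differentiable f x -> twice_differentiable g x ->
  \forall y \near x,
    (f * pderive v g + g * pderive v f) y = pderive v (f * g) y.
Proof.
move=> [df _] [dg _]; near=> y.
have dfy : differentiable f y by near: y.
have dgy : differentiable g y by near: y.
by rewrite pderiveM//; exact: diff_derivable.
Unshelve. all: by end_near. Qed.

Lemma pderive2D f g x v w :
  twice_differentiable f x -> twice_differentiable g x ->
  pderive w (pderive v (f + g)) x =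
  pderive w (pderive v f) x + pderive w (pderive v g) x.
Proof.
move=> tf tg; rewrite -(near_eq_pderive _ (near_pderiveD v tf tg)).
by rewrite pderiveD//; [exact: tf.2|exact: tg.2].
Qed.

Lemma pderive2M f g x v w :
  twice_differentiable f x -> twice_differentiable g x ->
  pderive w (pderive v (f * g)) x =
  f x * pderive w (pderive v g) x + pderive v g x * pderive w f x +
  (g x * pderive w (pderive v f) x + pderive v f x * pderive w g x).
Proof.
move=> tf tg; rewrite -(near_eq_pderive _ (near_pderiveM v tf tg)).
have df : derivable f x w by exact: twice_differentiable_derivable.
have dg : derivable g x w by exact: twice_differentiable_derivable.
have df2 := tf.2 v w; have dg2 := tg.2 v w.
by rewrite (pderiveD (derivableM df dg2) (derivableM dg df2)) !pderiveM.
Qed.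

Lemma twice_differentiableD f g x :
  twice_differentiable f x -> twice_differentiable g x ->
  twice_differentiable (f + g) x.
Proof.
move=> tf tg; split=> [|v w].
  case: tf tg => df _ [dg _]; near=> y.
  by apply: differentiableD; near: y.
apply: (near_eq_derivable (near_pderiveD v tf tg)).
by apply: derivableD; [exact: tf.2|exact: tg.2].
Unshelve. all: by end_near. Qed.

Lemma twice_differentiableM f g x :
  twice_differentiable f x -> twice_differentiable g x ->
  twice_differentiable (f * g) x.
Proof.
move=> tf tg; split=> [|v w].
  case: tf tg => df _ [dg _]; near=> y.
  by apply: differentiableM; near: y.
apply: (near_eq_derivable (near_pderiveM v tf tg)).
have df : derivable f x w by exact: twice_differentiable_derivable.
have dg : derivable g x w by exact: twice_differentiable_derivable.
have df2 := tf.2 v w; have dg2 := tg.2 v w.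
exact: (derivableD (derivableM df dg2) (derivableM dg df2)).
Unshelve. all: by end_near. Qed.

Lemma twice_differentiable_sum k (f : 'I_k -> V -> R) x :
  (forall i, twice_differentiable (f i) x) ->
  twice_differentiable (\sum_i f i) x.
Proof.
move=> tf; apply: (big_ind (fun g => twice_differentiable g x)).
- exact: (twice_differentiable_cst 0).
- by move=> g h; exact: twice_differentiableD.
- by move=> i _; exact: tf.
Qed.

End TwiceDifferentiable.

Definition drift_laplacian {R : realType} {V : normedModType R} {n : nat}
    (e : 'I_n -> V) (b : V) (f : V -> R) (x : V) : R :=
  \sum_i pderive (e i) (pderive (e i) f) x - pderive b f x.

Definition carre_du_champ {R : realType} {V : normedModType R} {n : nat}
    (e : 'I_n -> V) (f g : V -> R) (x : V) : R :=
  \sum_i pderive (e i) f x * pderive (e i) g x.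

Section DriftLaplacian.
Context {R : realType} {V : normedModType R} {n : nat}.
Variables (e : 'I_n -> V) (b x : V).
Implicit Types f g : V -> R.

Notation L f := (drift_laplacian e b f x).
Notation Gamma f g := (carre_du_champ e f g x).

Lemma drift_laplacian_cst (a : R) : L (cst a) = 0.
Proof.
rewrite /drift_laplacian pderive_cst subr0 big1// => i _.
by rewrite !pderive_cst.
Qed.

Lemma drift_laplacianD f g :
  twice_differentiable f x -> twice_differentiable g x ->
  L (f + g) = L f + L g.
Proof.
move=> tf tg; rewrite /drift_laplacian.
rewrite (eq_bigr _ (fun i _ => pderive2D (e i) (e i) tf tg)).
rewrite pderiveD; try exact: twice_differentiable_derivable.
by rewrite big_split/= opprD addrACA.
Qed.

Lemma drift_laplacianM f g :
  twice_differentiable f x -> twice_differentiable g x ->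
  L (f * g) = f x * L g + g x * L f + 2 * Gamma f g.
Proof.
move=> tf tg; rewrite /drift_laplacian.
rewrite (eq_bigr _ (fun i _ => pderive2M (e i) (e i) tf tg)).
rewrite pderiveM; try exact: twice_differentiable_derivable.
rewrite !big_split/= -!mulr_sumr.
have -> : \sum_i pderive (e i) g x * pderive (e i) f x = Gamma f g.
  by apply: eq_bigr => i _; rewrite mulrC.
rewrite -/(carre_du_champ e f g x); ring.
Qed.

Lemma drift_laplacianZ (a : R) f :
  twice_differentiable f x -> L (cst a * f) = a * L f.
Proof.
move=> tf; rewrite (drift_laplacianM (twice_differentiable_cst a x) tf).
rewrite drift_laplacian_cst mulr0 addr0 /carre_du_champ big1 ?mulr0 ?addr0//.
by move=> i _; rewrite pderive_cst mul0r.
Qed.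

Lemma drift_laplacian_sum k (f : 'I_k -> V -> R) :
  (forall i, twice_differentiable (f i) x) ->
  L (\sum_i f i) = \sum_i L (f i).
Proof.
move=> tf.
suff [] : twice_differentiable (\sum_i f i) x /\
  L (\sum_i f i) = \sum_i L (f i) by [].
apply: (big_rec2 (fun g a => twice_differentiable g x /\ L g = a)).
  split; first exact: (twice_differentiable_cst 0).
  exact: (drift_laplacian_cst 0).
move=> i g a _ [tg <-].
have ti := tf i.
by split; [exact: twice_differentiableD|rewrite (drift_laplacianD ti tg)].
Qed.

End DriftLaplacian.

(** * The second derivative test *)

Section SecondDerivativeTest.
Context {R : realType} {V : normedModType R}.
Implicit Types (f g : V -> R) (x v : V).

(** Both difference quotients are the same function of the increment. *)
Lemma is_derive_line f x v (t : R) : derivable f (x + t *: v) v ->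
  is_derive t (1 : R) (fun s : R => f (x + s *: v)) (pderive v f (x + t *: v)).
Proof.
have E : (fun h : R => h^-1 *: (((fun s : R => f (x + s *: v)) \o shift t)
      (h *: (1 : R)) - f (x + t *: v))) =
   (fun h : R => h^-1 *: ((f \o shift (x + t *: v)) (h *: v) - f (x + t *: v))).
  apply/funext => h /=; congr (_ *: (f _ - _)).
  by rewrite [h *: 1]mulr1 scalerDl addrCA.
move=> df; apply: DeriveDef; last by rewrite pderive.unlock /derive E.
by rewrite /derivable E.
Qed.

(** Along the line [t |-> x + t v], a negative second derivative at the critical
    point [0] would make the first derivative negative just after [0], and the
    mean value theorem would produce a value smaller than the minimum. *)
Lemma local_min_second_derivative_ge0 f x v :
  twice_differentiable f x -> (\forall y \near x, f x <= f y) ->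
  pderive v f x = 0 /\ 0 <= pderive v (pderive v f) x.
Proof.
move=> tf fmin.
pose h (t : R) := f (x + t *: v); pose h' (t : R) := pderive v f (x + t *: v).
have cline : (fun t : R => x + t *: v) @ (0 : R) --> x.
  rewrite -[X in _ --> X]addr0 -[X in _ --> x + X](scale0r v).
  by apply: cvgD; [exact: cvg_cst|apply: cvgZl; exact: cvg_id].
have : \forall t \near (0 : R), derivable f (x + t *: v) v /\ f x <= f (x + t *: v).
  have df := cline _ tf.1; have fm := cline _ fmin; near=> t.
  split; last by near: t; exact: fm.
  by apply: diff_derivable; near: t; exact: df.
move=> /nbhs_ballP[d /= d0 dP].
have dh t : `|t| < d -> is_derive t (1 : R) h (h' t).
  move=> td; apply: is_derive_line; apply: (dP _ _).1.
  by rewrite -ball_normE/= sub0r normrN.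
have hmin t : `|t| < d -> h 0 <= h t.
  move=> td; rewrite /h scale0r addr0; apply: (dP _ _).2.
  by rewrite -ball_normE/= sub0r normrN.
have h'0 : h' 0 = 0.
  have : is_derive (0 : R) (1 : R) h 0.
    apply: (@derive1_at_min _ _ (- d) d).
    - by lra.
    - move=> t; rewrite in_itv/= => td; have /dh[] : `|t| < d by rewrite ltr_norml.
      done.
    - by rewrite in_itv/= d0 oppr_lt0 d0.
    - by move=> t; rewrite in_itv/= => td; apply: hmin; rewrite ltr_norml.
  have /dh : `|0 : R| < d by rewrite normr0.
  by move=> dh0 dh1; rewrite -(@derive_val _ _ _ _ _ _ _ dh0) derive_val.
have E0 : pderive v f x = h' 0 by rewrite /h' scale0r addr0.
split; first by rewrite E0.
rewrite leNgt; apply/negP => lt0.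
have dh' : is_derive (0 : R) (1 : R) h' (pderive v (pderive v f) x).
  have -> : pderive v (pderive v f) x = pderive v (pderive v f) (x + 0 *: v).
    by rewrite scale0r addr0.
  by apply: is_derive_line; rewrite scale0r addr0; exact: tf.2.
have : h^-1 *: ((h' \o shift 0) (h *: 1) - h' 0) @[h --> (0:R)^'] -->
    pderive v (pderive v f) x.
  have [dd <-] := dh'.
  exact: dd.
move=> /cvgr_lt /(_ _ lt0) [r /= r0 rP].
(* close enough to 0 for both the minimality and the sign of [h'] *)
pose t := Num.min (d / 2) (r / 2).
have t0 : 0 < t by rewrite lt_min; apply/andP; split; lra.
have td : t <= d / 2 by rewrite ge_min lexx.
have tr : t <= r / 2 by rewrite ge_min lexx orbT.
have [||c] := @MVT _ h h' 0 t t0.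
- move=> c; rewrite in_itv/= => /andP[c0 ct]; apply: dh.
  by rewrite ltr_norml; apply/andP; split; lra.
- apply: continuous_in_subspaceT => c; rewrite inE/= in_itv/= => /andP[c0 ct].
  have /dh[dhc _] : `|c| < d by rewrite ltr_norml; apply/andP; split; lra.
  exact/differentiable_continuous/derivable1_diffP.
rewrite in_itv/= subr0 => /andP[c0 ct] E.
have /hmin : `|t| < d by rewrite ltr_norml; apply/andP; split; lra.
have : c^-1 *: ((h' \o shift 0) (c *: 1) - h' 0) < 0.
  by apply: rP => /=; [rewrite sub0r normrN gtr0_norm//; lra|rewrite gt_eqF].
rewrite /= h'0 subr0 addr0 [c *: 1]mulr1 => hc.
have : h' c < 0.
  rewrite -(pmulr_rlt0 (x := c^-1))// invr_gt0; lra.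
nra.
Unshelve. all: by end_near. Qed.

Lemma local_min_drift_laplacian_ge0 (n : nat) (e : 'I_n -> V) (b : V) f x :
  twice_differentiable f x -> (\forall y \near x, f x <= f y) ->
  0 <= drift_laplacian e b f x.
Proof.
move=> tf fmin; rewrite /drift_laplacian.
have [-> _] := local_min_second_derivative_ge0 b tf fmin.
rewrite subr0 sumr_ge0// => i _.
by have [] := local_min_second_derivative_ge0 (e i) tf fmin.
Qed.

End SecondDerivativeTest.

(** * Euclidean rows and coordinate functions *)

Section DotProduct.
Context {R : realType} {m : nat}.
Implicit Types x y z : 'rV[R]_m.

Lemma dotpC x y : dotp x y = dotp y x.
Proof. by apply: eq_bigr => i _; rewrite mulrC. Qed.

Lemma dotpDl x y z : dotp (x + y) z = dotp x z + dotp y z.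
Proof. by rewrite /dotp -big_split; apply: eq_bigr => i _; rewrite !mxE mulrDl. Qed.

Lemma dotpDr x y z : dotp z (x + y) = dotp z x + dotp z y.
Proof. by rewrite dotpC dotpDl !(dotpC z). Qed.

Lemma dotpZl (a : R) x y : dotp (a *: x) y = a * dotp x y.
Proof. by rewrite /dotp mulr_sumr; apply: eq_bigr => i _; rewrite !mxE mulrA. Qed.

Lemma dotpZr (a : R) x y : dotp x (a *: y) = a * dotp x y.
Proof. by rewrite dotpC dotpZl dotpC. Qed.

Lemma dotp0l x : dotp 0 x = 0.
Proof. by rewrite -(scale0r 0) dotpZl mul0r. Qed.

Lemma dotp0r x : dotp x 0 = 0.
Proof. by rewrite dotpC dotp0l. Qed.

Lemma dotpNl x y : dotp (- x) y = - dotp x y.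
Proof. by rewrite -scaleN1r dotpZl mulN1r. Qed.

Lemma dotpNr x y : dotp x (- y) = - dotp x y.
Proof. by rewrite dotpC dotpNl dotpC. Qed.

Lemma dotpBl x y z : dotp (x - y) z = dotp x z - dotp y z.
Proof. by rewrite dotpDl dotpNl. Qed.

Lemma dotpBr x y z : dotp z (x - y) = dotp z x - dotp z y.
Proof. by rewrite dotpDr dotpNr. Qed.

Lemma dotp_suml k (f : 'I_k -> 'rV[R]_m) y :
  dotp (\sum_i f i) y = \sum_i dotp (f i) y.
Proof.
apply: (big_ind2 (fun z a => dotp z y = a)) => //; first by rewrite dotp0l.
by move=> z1 a1 z2 a2 <- <-; rewrite dotpDl.
Qed.

Lemma dotp_sumr k (f : 'I_k -> 'rV[R]_m) y :
  dotp y (\sum_i f i) = \sum_i dotp y (f i).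
Proof. by rewrite dotpC dotp_suml; apply: eq_bigr => i _; rewrite dotpC. Qed.

Lemma dotp_ge0 x : 0 <= dotp x x.
Proof. by apply: sumr_ge0 => i _; rewrite -expr2 sqr_ge0. Qed.

Lemma dotp_eq0 x : dotp x x = 0 -> x = 0.
Proof.
move=> /eqP; rewrite psumr_eq0 => [/allP x0|i _]; last by rewrite -expr2 sqr_ge0.
apply/rowP => i; rewrite mxE; have := x0 i (mem_index_enum i).
by rewrite /= -expr2 sqrf_eq0 => /eqP.
Qed.

Lemma dotp_gt0 x : x != 0 -> 0 < dotp x x.
Proof.
by move=> x0; rewrite lt0r dotp_ge0 andbT; apply: contra_neq x0; exact: dotp_eq0.
Qed.

Lemma dotp_sqr_le x y : dotp x y ^+ 2 <= dotp x x * dotp y y.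
Proof.
have [->|y0] := eqVneq y 0; first by rewrite !dotp0r expr0n mulr0.
have y_gt0 := dotp_gt0 y0.
have := dotp_ge0 (dotp y y *: x - dotp x y *: y).
rewrite dotpBl !dotpBr !dotpZl !dotpZr (dotpC y x).
move: (dotp x x) (dotp x y) (dotp y y) y_gt0 => a b c c0 H.
rewrite -subr_ge0 -(pmulr_rge0 (x := c))//; nra.
Qed.

Lemma normr_sqr_le_dotp x : `|x| ^+ 2 <= dotp x x.
Proof.
have [->|x0] := eqVneq `|x| 0; first by rewrite expr0n dotp_ge0.
have [[i j] /= E] := mx_norm_neq0 x0.
rewrite [`|x|]E (ord1 i) real_normK ?num_real// /dotp (bigD1 j)//= expr2 lerDl.
by apply: sumr_ge0 => k _; rewrite -expr2 sqr_ge0.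
Qed.

Lemma dotp_orthonormal n (E : 'I_n -> 'rV[R]_m) (a b : 'I_n -> R) :
  (forall i j, dotp (E i) (E j) = (i == j)%:R) ->
  dotp (\sum_i a i *: E i) (\sum_i b i *: E i) = \sum_i a i * b i.
Proof.
move=> oE; rewrite dotp_suml; apply: eq_bigr => i _.
rewrite dotpZl dotp_sumr (bigD1 i)//= dotpZr oE eqxx mulr1 big1 ?addr0// => j ji.
by rewrite dotpZr oE eq_sym (negbTE ji) mulr0.
Qed.

End DotProduct.

Section Coordinates.
Context {R : realType} {V : normedModType R} {m : nat}.
Implicit Types (F : V -> 'rV[R]_m) (x v : V).

Definition coord_fun F (k : 'I_m) : V -> R := fun y => F y 0 k.

Lemma differentiable_coord_fun F k x :
  differentiable F x -> differentiable (coord_fun F k) x.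
Proof.
move=> dF; rewrite /coord_fun.
rewrite (_ : (fun y => _) = (fun N : 'rV[R]_m => N 0 k) \o F)//.
by apply: differentiable_comp => //; exact: differentiable_coord.
Qed.

Lemma differentiable_row F x :
  (forall k, differentiable (coord_fun F k) x) -> differentiable F x.
Proof.
move=> dF; have -> : F = \sum_k (fun y => coord_fun F k y *: delta_mx 0 k).
  apply/funext => y; rewrite fct_sumE; exact: row_sum_delta.
by apply: differentiable_sum => k; exact: differentiableZl.
Qed.

Lemma pderive_coord_fun F k x v : derivable F x v ->
  pderive v (coord_fun F k) x = ('D_v F x) 0 k.
Proof. by move=> dF; rewrite pderive.unlock derive_mx// mxE. Qed.

Lemma pderive_diff (f : V -> R) x v :
  differentiable f x -> pderive v f x = 'd f x v.
Proof. by move=> df; rewrite pderive.unlock deriveE. Qed.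

Lemma pderive_sum_dir (f : V -> R) x n (a : 'I_n -> R) (v : 'I_n -> V) :
  differentiable f x ->
  pderive (\sum_i a i *: v i) f x = \sum_i a i * pderive (v i) f x.
Proof.
move=> df; rewrite pderive_diff// linear_sum; apply: eq_bigr => i _.
by rewrite linearZ pderive_diff.
Qed.

End Coordinates.

(** * Adapted frames and squared distances *)

(** At the point [x], the vectors [e i] are orthonormal for the metric induced by
    [F], so that [drift_laplacian e b] has the principal part of the Laplacian of
    that metric; the second clause selects the [b] for which its value on the
    coordinates is that of the drift Laplacian of a self-shrinker. *)
Definition adapted {R : realType} {n m : nat} (F : 'rV[R]_n -> 'rV[R]_m)
    (x : 'rV[R]_n) (e : 'I_n -> 'rV[R]_n) (b : 'rV[R]_n) : Prop :=
  (forall i j, dotp ('D_(e i) F x) ('D_(e j) F x) = (i == j)%:R) /\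
  (forall k, drift_laplacian e b (coord_fun F k) x = - 2^-1 * F x 0 k).

Lemma dotp_row {R : realType} (m : nat) (a b : 'I_m -> R) :
  dotp (\row_i a i) (\row_i b i) = \sum_i a i * b i.
Proof. by apply: eq_bigr => i _; rewrite !mxE. Qed.

Section OrthonormalFrame.
Context {R : realType} {n m : nat}.
Variables (F : 'rV[R]_n -> 'rV[R]_m) (x : 'rV[R]_n) (e : 'I_n -> 'rV[R]_n).
Hypothesis dF : differentiable F x.
Hypothesis oe : forall i j, dotp ('D_(e i) F x) ('D_(e j) F x) = (i == j)%:R.

(** With [A] the matrix of the [e i] and [J] the Jacobian of [F], orthonormality
    reads [A J (A J)^T = 1], so [A] is invertible. *)
Lemma orthonormal_frame_basis (v : 'rV[R]_n) : exists a : 'I_n -> R,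
  v = \sum_i a i *: e i /\ \sum_i a i ^+ 2 = dotp ('D_v F x) ('D_v F x).
Proof.
pose A := \matrix_i e i; pose J := jacobian F x.
have AJ i : row i (A *m J) = 'D_(e i) F x.
  by rewrite row_mul rowK -deriveEjacobian.
have AJ1 : A *m (J *m (A *m J)^T) = 1%:M.
  rewrite mulmxA; apply/matrixP => i j; rewrite !mxE -oe.
  by apply: eq_bigr => k _; rewrite -!AJ !mxE.
have [uA _] := mulmx1_unit AJ1.
exists (fun i => (v *m invmx A) 0 i).
have Ev : v = \sum_i (v *m invmx A) 0 i *: e i.
  rewrite -[LHS](mulmxKV uA) mulmx_sum_row; apply: eq_bigr => i _.
  by rewrite rowK.
split=> //; have -> : 'D_v F x = \sum_i (v *m invmx A) 0 i *: 'D_(e i) F x.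
  rewrite deriveE// [in LHS]Ev linear_sum.
  by apply: eq_bigr => i _; rewrite linearZ deriveE.
by rewrite (dotp_orthonormal _ _ oe); apply: eq_bigr => i _; rewrite expr2.
Qed.

(** This replaces ellipticity: a lower bound for one derivative of [f] along a
    fixed direction bounds the squared gradient from below, whatever the frame. *)
Lemma carre_du_champ_ge (f : 'rV[R]_n -> R) (v : 'rV[R]_n) :
  differentiable f x ->
  pderive v f x ^+ 2 <= dotp ('D_v F x) ('D_v F x) * carre_du_champ e f f x.
Proof.
move=> df; have [a [-> <-]] := orthonormal_frame_basis v.
rewrite pderive_sum_dir//.
have := dotp_sqr_le (\row_i a i) (\row_i pderive (e i) f x).
rewrite !dotp_row.
have -> // : \sum_i a i * a i = \sum_i a i ^+ 2.
by apply: eq_bigr => i _; rewrite expr2.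
Qed.

End OrthonormalFrame.

Lemma dotp_mulmx_le {R : realType} {m k : nat} (v : 'rV[R]_m) (P : 'M[R]_(m, k)) :
  dotp (v *m P) (v *m P) <= dotp v v * \sum_j \sum_i P i j ^+ 2.
Proof.
rewrite mulr_sumr; apply: ler_sum => j _; rewrite -expr2.
have := dotp_sqr_le v (\row_i P i j).
rewrite [X in X ^+ 2 <= _](_ : _ = (v *m P) 0 j); last first.
  by rewrite mxE; apply: eq_bigr => i _; rewrite mxE.
by rewrite [X in _ <= _ * X](_ : _ = \sum_i P i j ^+ 2)//;
  apply: eq_bigr => i _; rewrite mxE.
Qed.

(** Two linear maps [P] matter: one that inverts the differential of [F] at a
    point, so that [F *m P] is a system of local coordinates, and [P = 1], which
    with [Y = 0] gives the squared norm of [F]. *)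
Definition sqdist_fun {R : realType} {V : normedModType R} {m k : nat}
    (F : V -> 'rV[R]_m) (P : 'M[R]_(m, k)) (Y : 'rV[R]_k) : V -> R :=
  fun y => dotp (F y *m P - Y) (F y *m P - Y).

Definition affine_fun {R : realType} {V : normedModType R} {m k : nat}
    (F : V -> 'rV[R]_m) (P : 'M[R]_(m, k)) (Y : 'rV[R]_k) (j : 'I_k) : V -> R :=
  \sum_i (cst (P i j) * coord_fun F i) + cst (- Y 0 j).

Section SquaredDistance.
Context {R : realType} {V : normedModType R} {m k : nat}.
Variables (F : V -> 'rV[R]_m) (P : 'M[R]_(m, k)) (Y : 'rV[R]_k).

Lemma affine_funE j y : affine_fun F P Y j y = (F y *m P - Y) 0 j.
Proof.
rewrite /affine_fun !mxE /= fctE fct_sumE; congr (_ + _).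
by apply: eq_bigr => i _; rewrite mulrC.
Qed.

Lemma sqdist_funE : sqdist_fun F P Y = \sum_j (affine_fun F P Y j * affine_fun F P Y j).
Proof.
apply/funext => y; rewrite fct_sumE; apply: eq_bigr => j _.
by rewrite -!affine_funE.
Qed.

Variable x : V.
Hypothesis tF : forall i, twice_differentiable (coord_fun F i) x.

Lemma twice_differentiable_affine j : twice_differentiable (affine_fun F P Y j) x.
Proof.
apply: twice_differentiableD; last exact: twice_differentiable_cst.
apply: twice_differentiable_sum => i.
by apply: twice_differentiableM => //; exact: twice_differentiable_cst.
Qed.

Lemma twice_differentiable_sqdist : twice_differentiable (sqdist_fun F P Y) x.
Proof.
rewrite sqdist_funE; apply: twice_differentiable_sum => j.
by apply: twice_differentiableM; exact: twice_differentiable_affine.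
Qed.

Lemma pderive_sum p (f : 'I_p -> V -> R) v :
  (forall i, derivable (f i) x v) ->
  pderive v (\sum_i f i) x = \sum_i pderive v (f i) x.
Proof. by move=> df; rewrite pderive.unlock derive_sum. Qed.

Lemma pderive_affine j v :
  pderive v (affine_fun F P Y j) x = ('D_v F x *m P) 0 j.
Proof.
have dF : differentiable F x.
  by apply: differentiable_row => i; exact: twice_differentiable1.
have dFi i : derivable (cst (P i j) * coord_fun F i) x v.
  by apply: derivableM; [exact: derivable_cst|exact: twice_differentiable_derivable].
rewrite pderiveD; last 2 first.
- exact: derivable_sum.
- exact: derivable_cst.
rewrite pderive_cst addr0 pderive_sum// mxE; apply: eq_bigr => i _.
rewrite pderiveM; [|exact: derivable_cst|exact: twice_differentiable_derivable].
rewrite pderive_cst mulr0 addr0 pderive_coord_fun//; first by rewrite mulrC.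
exact: diff_derivable.
Qed.

Lemma pderive_sqdist v :
  pderive v (sqdist_fun F P Y) x = 2 * dotp (F x *m P - Y) ('D_v F x *m P).
Proof.
have da j : derivable (affine_fun F P Y j) x v.
  exact/twice_differentiable_derivable/twice_differentiable_affine.
rewrite sqdist_funE pderive_sum; last by move=> j; exact: derivableM.
rewrite mulr_sumr; apply: eq_bigr => j _; rewrite pderiveM//.
by rewrite pderive_affine affine_funE; ring.
Qed.

Lemma drift_laplacian_affine n (e : 'I_n -> V) b j :
  (forall i, drift_laplacian e b (coord_fun F i) x = - 2^-1 * F x 0 i) ->
  drift_laplacian e b (affine_fun F P Y j) x = - 2^-1 * (F x *m P) 0 j.
Proof.
move=> LF; have tc i := twice_differentiable_cst (P i j) x.
have tm i := twice_differentiableM (tc i) (tF i).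
rewrite (drift_laplacianD e b (twice_differentiable_sum tm)); last first.
  exact: twice_differentiable_cst.
rewrite drift_laplacian_cst addr0 (drift_laplacian_sum e b tm).
rewrite mxE mulr_sumr; apply: eq_bigr => i _.
by rewrite drift_laplacianZ// LF; ring.
Qed.

Lemma drift_laplacian_sqdist n (e : 'I_n -> V) b :
  (forall i, drift_laplacian e b (coord_fun F i) x = - 2^-1 * F x 0 i) ->
  drift_laplacian e b (sqdist_fun F P Y) x =
  2 * (\sum_i dotp ('D_(e i) F x *m P) ('D_(e i) F x *m P))
  - dotp (F x *m P - Y) (F x *m P).
Proof.
move=> LF; have ta := twice_differentiable_affine.
have taa j := twice_differentiableM (ta j) (ta j).
rewrite sqdist_funE (drift_laplacian_sum e b taa).
rewrite exchange_big/= mulr_sumr -sumrB; apply: eq_bigr => j _.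
rewrite (drift_laplacianM e b (ta j) (ta j)) drift_laplacian_affine// -affine_funE.
rewrite (_ : carre_du_champ _ _ _ _ =
    \sum_i ('D_(e i) F x *m P) 0 j * ('D_(e i) F x *m P) 0 j); first by field.
by apply: eq_bigr => i _; rewrite !pderive_affine.
Qed.

End SquaredDistance.

(** * Compactness and continuity for rows *)

Lemma closed_setI_preimage {T U : topologicalType} (A : set T) (B : set U)
    (f : T -> U) :
  closed A -> (forall x, A x -> {for x, continuous f}) -> closed B ->
  closed (A `&` f @^-1` B).
Proof.
move=> cA cf cB x clx.
have Ax : A x by apply: cA; apply: closure_subset clx => y [].
split=> //; apply: cB => W /(cf x Ax) /clx [y [[Ay By] Wy]].
by exists (f y).
Qed.

Section CompactBalls.
Context {R : realType} {n : nat}.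

Definition cube (z : 'rV[R]_n) (s : R) : set 'rV[R]_n := [set x | `|x - z| <= s].

Lemma normB_continuous (z : 'rV[R]_n) : continuous (fun x : 'rV[R]_n => `|x - z|).
Proof.
move=> x; apply: (@continuous_comp _ _ _ (fun y : 'rV[R]_n => y - z)).
  by apply: continuousB; [exact: cvg_id|exact: cst_continuous].
exact: norm_continuous.
Qed.

Lemma compact_cube (z : 'rV[R]_n) s : compact (cube z s).
Proof.
apply: bounded_closed_compact.
  exists (`|z| + s); split; first exact: num_real.
  move=> M sM x /= xs; apply/ltW/(le_lt_trans _ sM).
  by rewrite -[x](subrK z) addrC (le_trans (ler_normD _ _))// lerD2l.
have -> : cube z s = setT `&` (fun x => `|x - z|) @^-1` [set y | y <= s].
  by rewrite setTI.
apply: closed_setI_preimage; [exact: closedT|by move=> x _; exact: normB_continuous|].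
exact: closed_le.
Qed.

Lemma nbhs_cubeP (z : 'rV[R]_n) (Q : set 'rV[R]_n) :
  (\forall x \near z, Q x) -> exists2 s, 0 < s & forall x, `|x - z| <= s -> Q x.
Proof.
move=> /nbhs_ballP[r /= r0 rQ]; exists (r / 2); first by rewrite divr_gt0.
move=> x xz; apply: rQ; rewrite -ball_normE/= distrC (le_lt_trans xz)//.
by rewrite ltr_pdivrMr// ltr_pMr// ltr1n.
Qed.

Lemma nbhs_lt_cube (z x : 'rV[R]_n) (s : R) : `|x - z| < s ->
  \forall y \near x, `|y - z| < s.
Proof. by move=> xz; have /cvgr_lt /(_ _ xz) := @normB_continuous z x. Qed.

End CompactBalls.

Lemma continuous_sum {R : realType} {T : topologicalType} {W : normedModType R}
    k (f : 'I_k -> T -> W) x :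
  (forall i, {for x, continuous (f i)}) ->
  {for x, continuous (fun y => \sum_i f i y)}.
Proof.
move=> cf; rewrite (_ : (fun y => _) = \sum_i f i); last first.
  by apply/funext => y; rewrite fct_sumE.
apply: (big_ind (fun g : T -> W => {for x, continuous g})).
- exact: cst_continuous.
- by move=> g h cg ch; exact: continuousD.
- by move=> i _; exact: cf.
Qed.

Section ContinuousRows.
Context {R : realType} {T : topologicalType} {m : nat}.
Implicit Types f g : T -> 'rV[R]_m.

Lemma continuous_coord_fun f x k : {for x, continuous f} ->
  {for x, continuous (fun y => f y 0 k)}.
Proof.
move=> cf; apply: (@continuous_comp _ _ _ f (fun N : 'rV[R]_m => N 0 k)) => //.
exact: coord_continuous.
Qed.

Lemma continuous_dotp f g x :
  {for x, continuous f} -> {for x, continuous g} ->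
  {for x, continuous (fun y => dotp (f y) (g y))}.
Proof.
move=> cf cg; rewrite /dotp; apply: continuous_sum => i.
by apply: continuousM; exact: continuous_coord_fun.
Qed.

Lemma continuous_mulmxr f k (P : 'M[R]_(m, k)) x :
  {for x, continuous f} -> {for x, continuous (fun y => f y *m P)}.
Proof.
move=> cf; rewrite (_ : (fun y => _) = fun y => \sum_i f y 0 i *: row i P).
  apply: continuous_sum => i; apply: cvgZl; exact: continuous_coord_fun.
by apply/funext => y; rewrite mulmx_sum_row.
Qed.

End ContinuousRows.

(** * Touching from inside *)

(** The barrier is [t + K t^2] with [t = a - q]: near [t = 0] it has the sign of
    [t], and [K t^2] contributes [2 K |grad q|^2] to its drift Laplacian, which
    dominates the other terms when [K] is large. *)
Section Barrier.
Context {R : realType} {V : normedModType R}.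
Variables (q : V -> R) (a K : R).

Definition barrier : V -> R :=
  let tau := cst a + cst (- 1) * q in tau + cst K * (tau * tau).

Lemma barrierE x : barrier x = (a - q x) + K * (a - q x) ^+ 2.
Proof. by rewrite /barrier !fctE/= mulN1r expr2. Qed.

Lemma twice_differentiable_barrier x :
  twice_differentiable q x -> twice_differentiable barrier x.
Proof.
move=> tq; have tc c := twice_differentiable_cst c x.
have tt := twice_differentiableD (tc a) (twice_differentiableM (tc (-1)) tq).
apply: (twice_differentiableD tt).
exact: (twice_differentiableM (tc K) (twice_differentiableM tt tt)).
Qed.

Lemma drift_laplacian_barrier n (e : 'I_n -> V) b x :
  twice_differentiable q x ->
  drift_laplacian e b barrier x =
  - (1 + 2 * K * (a - q x)) * drift_laplacian e b q x
  + 2 * K * carre_du_champ e q q x.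
Proof.
move=> tq; have tc c := twice_differentiable_cst c x.
pose tau : V -> R := cst a + cst (- 1) * q.
have tm := twice_differentiableM (tc (-1)) tq.
have tt : twice_differentiable tau x by exact: (twice_differentiableD (tc a) tm).
have tt2 := twice_differentiableM tt tt.
have Lt : drift_laplacian e b tau x = - drift_laplacian e b q x.
  rewrite (drift_laplacianD e b (tc a) tm) drift_laplacian_cst add0r.
  by rewrite drift_laplacianZ// mulN1r.
have Gt : carre_du_champ e tau tau x = carre_du_champ e q q x.
  apply: eq_bigr => i _.
  have -> : pderive (e i) tau x = - pderive (e i) q x; last by rewrite mulrNN.
  have dc c : derivable (cst c : V -> R) x (e i) by exact: derivable_cst.
  have dq : derivable q x (e i) by exact: twice_differentiable_derivable.
  rewrite (pderiveD (dc a) (derivableM (dc (-1)) dq)) (pderiveM (dc (-1)) dq).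
  by rewrite !pderive_cst add0r mulr0 addr0 mulN1r.
rewrite (drift_laplacianD e b tt (twice_differentiableM (tc K) tt2)).
rewrite drift_laplacianZ// (drift_laplacianM e b tt tt) Lt Gt.
by rewrite /tau !fctE/= mulN1r; ring.
Qed.

Lemma drift_laplacian_barrier_gt0 n (e : 'I_n -> V) b x (A c : R) :
  twice_differentiable q x -> 0 < A -> 0 < K -> K * c = A ->
  drift_laplacian e b q x <= A -> c <= carre_du_champ e q q x ->
  `|K * (a - q x)| <= 4^-1 ->
  0 < drift_laplacian e b barrier x.
Proof.
move=> tq A0 K0 KcA LA cG; rewrite ler_norml => /andP[t1 t2].
rewrite drift_laplacian_barrier//.
have : A <= K * carre_du_champ e q q x by rewrite -KcA ler_pM2l.
have : (1 + 2 * K * (a - q x)) * drift_laplacian e b q x <= 3 / 2 * A.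
  apply: (@le_trans _ _ ((1 + 2 * K * (a - q x)) * A)).
    by rewrite ler_pM2l//; move: t1 t2; lra.
  by rewrite ler_pM2r//; move: t1 t2; lra.
rewrite -mulrA mulNr; lra.
Qed.

End Barrier.

(** Hopf's touching argument. [u] is a nonnegative supersolution that vanishes at
    [z], and [q], a squared distance in [n] linear coordinates of [F], is not
    critical at [z]. *)
Section Touching.
Context {R : realType} {n m k : nat}.
Variables (F : 'rV[R]_n -> 'rV[R]_m) (P : 'M[R]_(m, k)) (Y : 'rV[R]_k).
Variables (u : 'rV[R]_n -> R) (z xi : 'rV[R]_n).
Let q := sqdist_fun F P Y.

Hypothesis tF : \forall x \near z, forall j, twice_differentiable (coord_fun F j) x.
Hypothesis cD : forall v, {for z, continuous ('D_v F)}.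
Hypothesis tu : \forall x \near z, twice_differentiable u x.
Hypothesis u_ge0 : \forall x \near z, 0 <= u x.
Hypothesis super_u : \forall x \near z,
  exists e b, adapted F x e b /\ drift_laplacian e b u x <= 0.
Hypothesis uz : u z = 0.
Hypothesis qxi : pderive xi q z != 0.

Let differentiable_F x : (forall j, twice_differentiable (coord_fun F j) x) ->
  differentiable F x.
Proof.
by move=> tFx; apply: differentiable_row => j; exact/twice_differentiable1/tFx.
Qed.

Let continuous_F : {for z, continuous F}.
Proof. exact/differentiable_continuous/differentiable_F/(nbhs_singleton tF). Qed.

Let continuous_FP : {for z, continuous (fun x => F x *m P)}.
Proof. exact: continuous_mulmxr. Qed.

Let continuous_FPY : {for z, continuous (fun x => F x *m P - Y)}.
Proof. by apply: continuousB; [exact: continuous_FP|exact: cst_continuous]. Qed.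

(** The images of the frame are unit vectors, so the gradient terms are bounded
    by the norm of [P]; the rest is a continuous function of [F]. *)
Lemma drift_laplacian_sqdist_bounded : exists2 A, 0 < A &
  \forall x \near z, forall e b, adapted F x e b -> drift_laplacian e b q x <= A.
Proof.
pose t x := dotp (F x *m P - Y) (F x *m P).
have ct : {for z, continuous t} := continuous_dotp continuous_FPY continuous_FP.
pose p := \sum_j \sum_i P i j ^+ 2.
have p0 : 0 <= p by apply: sumr_ge0 => j _; apply: sumr_ge0 => i _; exact: sqr_ge0.
have np : 0 <= 2 * (n%:R * p) by rewrite mulr_ge0// mulr_ge0.
exists (2 * (n%:R * p) + `|t z| + 1); first by have := normr_ge0 (t z); lra.
have tz1 : t z - 1 < t z by lra.
have tn : \forall x \near z, t z - 1 < t x by have /cvgr_gt /(_ _ tz1) := ct.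
near=> x => e b eF.
have tFx : forall j, twice_differentiable (coord_fun F j) x by near: x.
have tx : t z - 1 < t x by near: x.
rewrite (drift_laplacian_sqdist _ _ tFx eF.2) -/(t x).
have : \sum_i dotp ('D_(e i) F x *m P) ('D_(e i) F x *m P) <= n%:R * p.
  rewrite -[n in n%:R]card_ord mulr_natl -sumr_const; apply: ler_sum => i _.
  by apply: le_trans (dotp_mulmx_le _ _) _; rewrite eF.1 eqxx mul1r.
have := ler_norm (- t z); rewrite normrN; lra.
Unshelve. all: by end_near. Qed.

Lemma carre_du_champ_sqdist_bounded : exists2 c, 0 < c &
  \forall x \near z, forall e b, adapted F x e b -> c <= carre_du_champ e q q x.
Proof.
pose g x := 2 * dotp (F x *m P - Y) ('D_xi F x *m P).
have gE x : (forall j, twice_differentiable (coord_fun F j) x) ->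
    pderive xi q x = g x.
  by move=> tFx; rewrite pderive_sqdist.
have cD2 : {for z, continuous (fun x => dotp ('D_xi F x) ('D_xi F x))}.
  exact (continuous_dotp (@cD xi) (@cD xi)).
have cg : {for z, continuous (fun x => g x ^+ 2)}.
  have cg1 : {for z, continuous g}.
    have cgz := continuous_dotp continuous_FPY
      (@continuous_mulmxr _ _ _ _ _ P _ (@cD xi)).
    by apply: continuousM; [exact: cst_continuous|exact: cgz].
  by apply: continuousM; exact: cg1.
have g0 : 0 < g z ^+ 2.
  by rewrite lt0r sqr_ge0 andbT sqrf_eq0 -gE//; exact: nbhs_singleton tF.
pose B := dotp ('D_xi F z) ('D_xi F z) + 1.
have B0 : 0 < B by have := dotp_ge0 ('D_xi F z); rewrite /B; lra.
exists (g z ^+ 2 / 2 / B); first by rewrite divr_gt0// divr_gt0.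
have g2 : g z ^+ 2 / 2 < g z ^+ 2 by lra.
have gn : \forall x \near z, g z ^+ 2 / 2 < g x ^+ 2 by have /cvgr_gt /(_ _ g2) := cg.
have BB : dotp ('D_xi F z) ('D_xi F z) < B by rewrite /B; lra.
have Bn : \forall x \near z, dotp ('D_xi F x) ('D_xi F x) < B.
  by have /cvgr_lt /(_ _ BB) := cD2.
near=> x => e b eF.
have tFx : forall j, twice_differentiable (coord_fun F j) x by near: x.
have Bx : dotp ('D_xi F x) ('D_xi F x) < B by near: x.
have gx : g z ^+ 2 / 2 < g x ^+ 2 by near: x.
have dq : differentiable q x.
  by apply: twice_differentiable1; exact: twice_differentiable_sqdist.
have := carre_du_champ_ge (differentiable_F tFx) eF.1 xi dq; rewrite (gE _ tFx) => H.
have G0 : 0 <= carre_du_champ e q q x.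
  by apply: sumr_ge0 => i _; rewrite -expr2 sqr_ge0.
rewrite ler_pdivrMr//.
apply: (le_trans (ltW gx)); apply: (le_trans H).
by rewrite [leRHS]mulrC; exact: (ler_wpM2r G0 (ltW Bx)).
Unshelve. all: by end_near. Qed.

(** If [u] were positive on the side [q <= q z] of the level set, except at [z],
    then [u - (d / 2) w], with [w] the barrier, would be positive on the boundary
    of a small cube around [z] and zero at [z]. Its minimum over the cube is then
    interior, where [L (u - (d / 2) w) >= 0]; but [L u <= 0] and [L w > 0]. *)
Lemma no_interior_touching :
  ~ (\forall x \near z, x != z -> q x <= q z -> 0 < u x).
Proof.
move=> touch.
have [A A0 LA] := drift_laplacian_sqdist_bounded.
have [c c0 cG] := carre_du_champ_sqdist_bounded.
(* then [2 K c = 2 A] exceeds [(3 / 2) A], which bounds [(1 + 2 K t) L q] as long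
   as [|K t| <= 1 / 4], where [t = q z - q x] *)
pose K := A / c.
have K0 : 0 < K by rewrite divr_gt0.
have KcA : K * c = A by rewrite divfK// gt_eqF.
have cq : {for z, continuous q}.
  exact (continuous_dotp continuous_FPY continuous_FPY).
have near_q d : 0 < d -> \forall x \near z, `|q z - q x| < d.
  by move=> d0; have /cvgr_dist_lt /(_ _ d0) := cq.
(* the bound [1 / (4 K)] keeps [|K t| < 1 / 4], the bound [1 / 2] keeps [w < 1] *)
have near_tau : \forall x \near z, `|q z - q x| < Num.min (4 * K)^-1 2^-1.
  by apply: near_q; rewrite lt_min !invr_gt0 ltr0n andbT mulr_gt0.
pose good (x : 'rV[R]_n) :=
  [/\ twice_differentiable u x, twice_differentiable q x &
    [/\ 0 <= u x, x != z -> q x <= q z -> 0 < u x,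
    `|q z - q x| < Num.min (4 * K)^-1 2^-1 &
    exists (e : 'I_n -> 'rV[R]_n) b, drift_laplacian e b u x <= 0 /\
      0 < drift_laplacian e b (barrier q (q z) K) x]].
have : \forall x \near z, good x.
  near=> x.
  have tFx : forall j, twice_differentiable (coord_fun F j) x by near: x.
  have tq : twice_differentiable q x by exact: twice_differentiable_sqdist.
  have tx : `|q z - q x| < Num.min (4 * K)^-1 2^-1 by near: x.
  have tux : twice_differentiable u x by near: x.
  have ux : 0 <= u x by near: x.
  have tchx : x != z -> q x <= q z -> 0 < u x by near: x.
  do 2!split=> //.
  have [e [b [eF Lu]]] : exists e b, adapted F x e b /\ drift_laplacian e b u x <= 0.
    by near: x.
  have LAx : forall e b, adapted F x e b -> drift_laplacian e b q x <= A by near: x.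
  have cGx : forall e b, adapted F x e b -> c <= carre_du_champ e q q x by near: x.
  exists e, b; split => //.
  apply: (drift_laplacian_barrier_gt0 tq A0 K0 KcA (LAx _ _ eF) (cGx _ _ eF)).
  rewrite normrM (gtr0_norm K0) mulrC -ler_pdivlMr//.
  move: tx; rewrite lt_min => /andP[/ltW + _]; rewrite invfM; exact.
move=> /nbhs_cubeP[s s0 sP].
pose S := [set x : 'rV[R]_n | `|x - z| = s].
have [d d0 dS] : exists2 d, 0 < d & forall x, S x -> q x <= q z -> d <= u x.
  pose S' := (cube z s `&` (fun x => `|x - z|) @^-1` [set y | s <= y]) `&`
             q @^-1` [set y | y <= q z].
  have cS' : compact S'.
    apply: (@subclosed_compact _ _ (cube z s)) => [||x [[]]//]; last first.
      exact: compact_cube.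
    apply: closed_setI_preimage; last exact: closed_le.
      apply: closed_setI_preimage; last exact: closed_ge.
      - by apply: compact_closed; [exact: norm_hausdorff|exact: compact_cube].
      - by move=> x _; exact: normB_continuous.
    move=> x [xs _]; have [_ tq _] := sP _ xs.
    exact/differentiable_continuous/twice_differentiable1.
  have S'P x : S x -> q x <= q z -> S' x by move=> Sx qx; rewrite /S' /S /cube /= Sx.
  have [[x0 S'x0]|S'0] := pselect (S' !=set0); last first.
    by exists 1 => // x Sx qx; exfalso; apply: S'0; exists x; exact: S'P.
  have [|c1 c1S c1min] := compact_EVT_min (ex_intro _ x0 S'x0) cS' (f := u).
  - apply: continuous_in_subspaceT => x; rewrite inE => -[[xs _] _].
    have [tux _ _] := sP _ xs.
    exact/differentiable_continuous/twice_differentiable1.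
  move: c1S; rewrite inE => -[[/= c1s c1s'] qc1].
  exists (u c1); last by move=> x Sx qx; apply: c1min; rewrite inE; exact: S'P.
  have [_ _ [_ + _ _]] := sP _ c1s; apply => //.
  apply/eqP => c1z; move: c1s'; rewrite c1z subrr normr0; lra.
pose w := barrier q (q z) K.
pose v : 'rV[R]_n -> R := u + cst (- (d / 2)) * w.
have vE x : v x = u x - d / 2 * w x by rewrite /v !fctE/= mulNr.
have cubez : cube z s z by rewrite /cube /= subrr normr0 ltW.
have tv x : cube z s x -> twice_differentiable v x.
  move=> xs; have [tux tq _] := sP _ xs.
  apply: (twice_differentiableD tux); apply: twice_differentiableM.
    exact: twice_differentiable_cst.
  exact: twice_differentiable_barrier.
have [|p ps pmin] :=
    compact_EVT_min (ex_intro _ z cubez) (@compact_cube R n z s) (f := v).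
  apply: continuous_in_subspaceT => x; rewrite inE => /tv tvx.
  exact/differentiable_continuous/twice_differentiable1.
move: ps; rewrite inE => ps; have {}pmin x : cube z s x -> v p <= v x.
  by move=> xs; apply: pmin; rewrite inE.
have vp : v p <= 0.
  apply: le_trans (pmin _ cubez) _.
  by rewrite vE uz /w barrierE subrr expr0n !mulr0 addr0 mulr0 subr0.
have [tup tqp [up _ taup [e [b [Lu Lw]]]]] := sP _ ps.
have wp : w p < 1 /\ (q z < q p -> w p < 0).
  rewrite /w barrierE.
  move: taup; rewrite lt_min !ltr_norml => /andP[/andP[t1 t2] /andP[t3 t4]].
  move: t1 t2 t3 t4; set tau := q z - q p => t1 t2 t3 t4.
  have Kt : - 4^-1 < K * tau < 4^-1.
    have E : 4^-1 = K * (4 * K)^-1 by field; rewrite gt_eqF.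
    by rewrite E -mulrN !ltr_pM2l// t1.
  have /andP[k1 k2] := Kt.
  have -> : tau + K * tau ^+ 2 = tau * (1 + K * tau) by ring.
  split; first nra.
  by move=> qq; have : tau < 0 by [rewrite /tau; lra]; nra.
have ps' : `|p - z| < s.
  rewrite lt_neqAle; apply/andP; split=> //; apply/eqP => Sp.
  have [qp|qp] := leP (q p) (q z).
    have := dS _ Sp qp; move: vp wp.1; rewrite vE; nra.
  have := wp.2 qp; move: vp up; rewrite vE; nra.
have : 0 <= drift_laplacian e b v p.
  apply: local_min_drift_laplacian_ge0; first exact: tv.
  near=> y; apply: pmin; apply: ltW.
  by near: y; exact: nbhs_lt_cube.
have tw := twice_differentiable_barrier (q z) K tqp.
rewrite (drift_laplacianD e b tup
  (twice_differentiableM (twice_differentiable_cst _ p) tw)).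
rewrite drift_laplacianZ// => H; have : 0 < d / 2 * drift_laplacian e b w p.
  by rewrite mulr_gt0// divr_gt0.
lra.
Unshelve. all: by end_near. Qed.

End Touching.

(** * The strong minimum principle *)

(** The quadratic form of [B - 1] at [v] is at most [n |v|^2] times the largest
    entry, by the inequality [2 |a b| <= a^2 + b^2]. *)
Lemma dotp_mulmx_ge_near_id {R : realType} {n : nat} (B : 'M[R]_n) (v : 'rV[R]_n) :
  (forall i j, `|B i j - (i == j)%:R| <= (2 * n.+1%:R)^-1) ->
  2^-1 * dotp v v <= dotp (v *m B) v.
Proof.
move=> Bid; pose eta : R := (2 * n.+1%:R)^-1.
have eta0 : 0 < eta by rewrite invr_gt0 mulr_gt0.
have eta_n : eta * n%:R <= 2^-1.
  rewrite /eta invfM -mulrA ler_piMr// ler_pdivrMl ?ltr0n// mulr1.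
  by rewrite ler_nat.
rewrite -[B](subrK 1%:M) mulmxDr mulmx1 dotpDl.
suff : - (eta * n%:R) * dotp v v <= dotp (v *m (B - 1%:M)) v.
  have := dotp_ge0 v; nra.
have -> : - (eta * n%:R) * dotp v v =
    \sum_j \sum_i - (eta * (2^-1 * (v 0 i ^+ 2 + v 0 j ^+ 2))).
  under [RHS]eq_bigr do rewrite sumrN -!mulr_sumr big_split/= sumr_const card_ord.
  rewrite sumrN -!mulr_sumr big_split/= sumr_const card_ord sumrMnl.
  have -> : \sum_i v 0 i ^+ 2 = dotp v v by apply: eq_bigr => i _; rewrite expr2.
  by rewrite -mulr_natr; field.
apply: ler_sum => j _; rewrite mxE mulr_suml; apply: ler_sum => i _.
rewrite !mxE.
have := Bid i j; rewrite -/eta ler_norml; move: (B i j - _) => c /andP[c1 c2].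
move: (v 0 i) (v 0 j) => a b.
rewrite -subr_ge0.
have -> : a * c * b - - (eta * (2^-1 * (a ^+ 2 + b ^+ 2))) =
  4^-1 * ((eta + c) * (a + b) ^+ 2 + (eta - c) * (a - b) ^+ 2) by field.
by rewrite mulr_ge0// addr_ge0// mulr_ge0 ?sqr_ge0//; lra.
Qed.

(** [P] is a left inverse of the differential at [z], so that the derivative of
    [F *m P] is the identity at [z] and close to it nearby. *)
Lemma near_coercive {R : realType} {n m : nat} (F : 'rV[R]_n -> 'rV[R]_m)
    (z : 'rV[R]_n) :
  (\forall x \near z, differentiable F x) ->
  (forall v, {for z, continuous ('D_v F)}) -> injective ('d F z) ->
  exists P : 'M[R]_(m, n), \forall x \near z, forall v,
    2^-1 * dotp v v <= dotp ('D_v F x *m P) v.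
Proof.
move=> dF cD iF; have dFz := nbhs_singleton dF; pose J := jacobian F z.
have JP : J *m pinvmx J = 1%:M.
  apply: mulmxVp; apply: inj_row_free => v.
  by rewrite -deriveEjacobian// deriveE// => dv0; apply: iF; rewrite dv0 linear0.
exists (pinvmx J).
pose B (x : 'rV[R]_n) (i j : 'I_n) := ('D_(delta_mx 0 i) F x *m pinvmx J) 0 j.
have BE x : differentiable F x ->
    forall i j, B x i j = (jacobian F x *m pinvmx J) i j.
  by move=> dFx i j; rewrite /B deriveEjacobian// -mulmxA -rowE mxE.
have eta0 : 0 < (2 * n.+1%:R)^-1 :> R by rewrite invr_gt0 mulr_gt0.
have Bn : \forall x \near z, forall i j,
    `|B x i j - (i == j)%:R| <= (2 * n.+1%:R)^-1.
  apply: (@filter_forall _ _ _ (nbhs z)) => i.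
  apply: (@filter_forall _ _ _ (nbhs z)) => j.
  have cB : {for z, continuous (fun x => B x i j)}.
    exact: (@continuous_coord_fun _ _ _ _ _ j
      (@continuous_mulmxr _ _ _ _ _ (pinvmx J) _ (cD _))).
  have Bz : B z i j = (i == j)%:R by rewrite BE// JP mxE.
  have /cvgr_distC_le /(_ _ eta0) := cB.
  by rewrite Bz.
near=> x => v.
have dFx : differentiable F x by near: x.
rewrite deriveEjacobian// -mulmxA; apply: dotp_mulmx_ge_near_id => i j.
by rewrite -BE//; move: i j; near: x.
Unshelve. all: by end_near. Qed.

(** The mean value theorem for [t |-> <F (y + t v) P, v>] with [v = x - y]. In
    particular [F *m P] is injective on the cube. *)
Lemma coercive_monotone {R : realType} {n m : nat} (F : 'rV[R]_n -> 'rV[R]_m)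
    (P : 'M[R]_(m, n)) (z : 'rV[R]_n) (s : R) :
  (forall x : 'rV[R]_n, `|x - z| <= s -> differentiable F x /\
    forall v, 2^-1 * dotp v v <= dotp ('D_v F x *m P) v) ->
  forall x y : 'rV[R]_n, `|x - z| <= s -> `|y - z| <= s ->
  2^-1 * dotp (x - y) (x - y) <= dotp (F x *m P - F y *m P) (x - y).
Proof.
move=> FP x y xs ys; set v := x - y.
pose g (w : 'rV[R]_n) : R := dotp (F w *m P) v.
have gs (t : R) : 0 <= t <= 1 -> `|y + t *: v - z| <= s.
  move=> /andP[t0 t1].
  have -> : y + t *: v - z = (1 - t) *: (y - z) + t *: (x - z).
    by rewrite /v !scalerBr !scalerBl !scale1r; apply/rowP => i; rewrite !mxE; ring.
  rewrite (le_trans (ler_normD _ _))// !normrZ !ger0_norm ?subr_ge0//.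
  have := normr_ge0 (y - z); have := normr_ge0 (x - z); nra.
have gE : g = \sum_j (cst (\sum_k P j k * v 0 k) * coord_fun F j).
  apply/funext => w; rewrite fct_sumE /g /dotp.
  transitivity (\sum_i \sum_j F w 0 j * P j i * v 0 i).
    by apply: eq_bigr => i _; rewrite mxE mulr_suml.
  rewrite exchange_big; apply: eq_bigr => j _ /=.
  by rewrite !fctE mulr_suml; apply: eq_bigr => i _; rewrite /coord_fun; ring.
have dg (t : R) : 0 <= t <= 1 -> is_derive t (1:R) (fun s : R => g (y + s *: v))
    (dotp ('D_v F (y + t *: v) *m P) v).
  move=> t01; have [dF _] := FP _ (gs _ t01).
  have dFj j : derivable (coord_fun F j) (y + t *: v) v.
    by apply: diff_derivable; exact: differentiable_coord_fun.
  have dc j : derivable (cst (\sum_k P j k * v 0 k) : 'rV[R]_n -> R) (y + t *: v) v.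
    exact: derivable_cst.
  have -> : dotp ('D_v F (y + t *: v) *m P) v = pderive v g (y + t *: v).
    rewrite gE pderive_sum; last by move=> j; exact: derivableM.
    transitivity (\sum_i \sum_j 'D_v F (y + t *: v) 0 j * P j i * v 0 i).
      by apply: eq_bigr => i _; rewrite mxE mulr_suml.
    rewrite exchange_big; apply: eq_bigr => j _ /=.
    rewrite (pderiveM (dc j) (dFj j)) pderive_cst mulr0 addr0.
    rewrite pderive_coord_fun; last exact: diff_derivable.
    by rewrite mulr_suml; apply: eq_bigr => i _; ring.
  apply: is_derive_line.
  rewrite gE; apply: derivable_sum => j; exact: derivableM.
have [| |c c01] := @MVT _ (fun s : R => g (y + s *: v))
    (fun t : R => dotp ('D_v F (y + t *: v) *m P) v) 0 1 ltr01.
- move=> t; rewrite in_itv/= => /andP[t0 t1]; apply: dg; lra.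
- apply: continuous_in_subspaceT => t; rewrite inE/= in_itv/= => t01.
  have [dgt _] := dg _ t01.
  exact/differentiable_continuous/derivable1_diffP.
have yv : y + v = x by rewrite /v addrC subrK.
rewrite scale1r scale0r addr0 subr0 mulr1 yv /g => E.
rewrite [leRHS]dotpBl E; move: c01; rewrite in_itv/= => /andP[c0 c1].
by apply: (FP _ (gs c _)).2; lra.
Qed.

Lemma dotp_le_add_sqr {R : realType} {n : nat} (p w : 'rV[R]_n) :
  dotp p w <= dotp p p + 4^-1 * dotp w w.
Proof.
have := dotp_ge0 (p - 2^-1 *: w).
rewrite !dotpBl !dotpBr !dotpZl !dotpZr (dotpC w p).
by move: (dotp p p) (dotp p w) (dotp w w) => a b c; lra.
Qed.

(** Let [G = F *m P] be the local coordinates of [near_coercive]. If [u y > 0] for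
    some [y] close to [z0], take the zero [z1] of [u] that is closest to [y] in
    the coordinates [G]; it stays inside the cube because [z0] itself is close to
    [y]. The ball centred at the midpoint [Y] of [G y] and [G z1] that passes
    through [G z1] touches the larger ball around [G y] only at [G z1], so [u] is
    positive on it except at [z1]; this is what [no_interior_touching] excludes. *)
Lemma strong_minimum_principle {R : realType} {n m : nat}
    (F : 'rV[R]_n -> 'rV[R]_m) (u : 'rV[R]_n -> R) (U : set 'rV[R]_n) z0 :
  open U ->
  (forall x, U x -> forall j, twice_differentiable (coord_fun F j) x) ->
  (forall x, U x -> forall v, {for x, continuous ('D_v F)}) ->
  (forall x, U x -> injective ('d F x)) ->
  (forall x, U x -> twice_differentiable u x) ->
  (forall x, U x -> 0 <= u x) ->
  (forall x, U x -> exists e b, adapted F x e b /\ drift_laplacian e b u x <= 0) ->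
  U z0 -> u z0 = 0 ->
  \forall x \near z0, u x = 0.
Proof.
move=> oU tF cD iF tu u0 su Uz0 uz0.
have nearU z : U z -> \forall x \near z, U x by move=> Uz; exact: open_nbhs_nbhs.
have dF x : U x -> differentiable F x.
  by move=> Ux; apply: differentiable_row => j; exact/twice_differentiable1/tF.
have ndF : \forall x \near z0, differentiable F x.
  by apply: filterS (nearU _ Uz0) => x; exact: dF.
have [P nP] := near_coercive ndF (cD _ Uz0) (iF _ Uz0).
have nUP : \forall x \near z0,
    U x /\ forall v, 2^-1 * dotp v v <= dotp ('D_v F x *m P) v.
  by apply: filterI nP; exact: nearU.
have [s s0 sP] := nbhs_cubeP nUP.
pose G x := F x *m P.
have mono : forall x y : 'rV[R]_n, `|x - z0| <= s -> `|y - z0| <= s ->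
    2^-1 * dotp (x - y) (x - y) <= dotp (G x - G y) (x - y).
  by apply: coercive_monotone => x /sP[Ux]; split=> //; exact: dF.
have injG (x y : 'rV[R]_n) :
    `|x - z0| <= s -> `|y - z0| <= s -> G x = G y -> x = y.
  move=> xs ys Gxy; apply/eqP; rewrite -subr_eq0; apply/eqP/dotp_eq0.
  have := mono _ _ xs ys; rewrite Gxy subrr dotp0l; have := dotp_ge0 (x - y); lra.
have cG x : U x -> {for x, continuous G}.
  by move=> Ux; apply: continuous_mulmxr; exact/differentiable_continuous/dF.
have cGB x (y : 'rV[R]_n) : U x -> {for x, continuous (fun w => G w - G y)}.
  move=> Ux; have cGx := cG _ Ux.
  by apply: continuousB; [exact: cGx|exact: cst_continuous].
have cDist x (y : 'rV[R]_n) : U x ->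
    {for x, continuous (fun w => dotp (G w - G y) (G w - G y))}.
  by move=> Ux; exact: (continuous_dotp (@cGB x y Ux) (@cGB x y Ux)).
(* by coercivity, points whose [G]-distance squared is below [c] are at distance
   below [s / 4] *)
pose c : R := (s / 4) ^+ 2 / 4.
have c0 : 0 < c by rewrite divr_gt0// exprn_gt0// divr_gt0.
have nD : \forall y \near z0, dotp (G y - G z0) (G y - G z0) < c.
  have Dz0 : dotp (G z0 - G z0) (G z0 - G z0) < c by rewrite subrr dotp0l.
  by have /cvgr_lt /(_ _ Dz0) := @cDist z0 z0 Uz0.
have s40 : `|z0 - z0| < s / 4 by rewrite subrr normr0 divr_gt0.
have ns : \forall y \near z0, `|y - z0| < s / 4 by exact: nbhs_lt_cube.
near=> y; have Dy : dotp (G y - G z0) (G y - G z0) < c by near: y.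
have ys : `|y - z0| < s / 4 by near: y.
apply: contrapT => uy.
pose Z := cube z0 (s / 2) `&` u @^-1` [set t | t <= 0].
have ss x : `|x - z0| <= s / 2 -> `|x - z0| <= s.
  by move=> /le_trans; apply; rewrite ler_pdivrMr// ler_pMr// ler1n.
have cu x : `|x - z0| <= s / 2 -> {for x, continuous u}.
  by move=> /ss /sP[Ux _]; exact/differentiable_continuous/twice_differentiable1/tu.
have Zz0 : Z z0.
  by split; rewrite /cube /= ?uz0// subrr normr0 divr_ge0// ltW.
have cZ : compact Z.
  apply: (@subclosed_compact _ _ (cube z0 (s / 2))) => [||x []//]; last first.
    exact: compact_cube.
  apply: closed_setI_preimage; [|exact: cu|exact: closed_le].
  by apply: compact_closed; [exact: norm_hausdorff|exact: compact_cube].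
have [|z1 + z1min] := compact_EVT_min (ex_intro _ z0 Zz0) cZ
    (f := fun w => dotp (G w - G y) (G w - G y)).
  apply: continuous_in_subspaceT => x; rewrite inE => -[/ss /sP[Ux _] _].
  exact: cDist.
rewrite inE => -[/= z1s uz1le].
have [Uz1 coer] := sP _ (ss _ z1s).
have uz1 : u z1 = 0 by apply/eqP; rewrite eq_le uz1le u0.
have ys' : `|y - z0| <= s by apply: ss; apply: ltW; apply: lt_le_trans ys _; lra.
have z1y : `|z1 - y| < s / 4.
  have : dotp (G z1 - G y) (G z1 - G y) < c.
    apply: le_lt_trans (z1min z0 _) _; first by rewrite inE.
    by rewrite -opprB dotpNl dotpNr opprK.
  have := mono _ _ (ss _ z1s) ys'.
  have := dotp_le_add_sqr (G z1 - G y) (z1 - y).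
  have := normr_sqr_le_dotp (z1 - y).
  move=> H1 H2 H3 H4; rewrite -(ltr_pXn2r (n := 2))// ?nnegrE ?divr_ge0// ?ltW//.
  rewrite /c in H4; lra.
have z1s' : `|z1 - z0| < s / 2.
  rewrite (_ : z1 - z0 = (z1 - y) + (y - z0)); last by rewrite addrA subrK.
  apply: le_lt_trans (ler_normD _ _) _; lra.
pose h := 2^-1 *: (G z1 - G y); pose Y := 2^-1 *: (G z1 + G y).
have hE : G z1 - Y = h by apply/rowP => i; rewrite !mxE; field.
(* [h] is the radius vector of the smaller ball at the touching point *)
have h0 : h != 0.
  apply/eqP => /eqP; rewrite scaler_eq0 invr_eq0 pnatr_eq0/= subr_eq0.
  by move=> /eqP /(injG _ _ (ss _ z1s) ys') z1yE; apply: uy; rewrite -z1yE.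
pose B := jacobian F z1 *m P.
have uB : B \in unitmx.
  rewrite -row_free_unit; apply: inj_row_free => v vB; apply: dotp_eq0.
  have := coer v; rewrite deriveEjacobian; last exact: dF.
  by rewrite -mulmxA vB dotp0l; have := dotp_ge0 v; lra.
pose xi := h *m invmx B.
have DxiE : 'D_xi F z1 *m P = h.
  by rewrite deriveEjacobian; [rewrite -mulmxA mulmxKV|exact: dF].
have nz1 (Q : 'rV[R]_n -> Prop) :
    (forall x, U x -> Q x) -> \forall x \near z1, Q x.
  by move=> UQ; apply: filterS (nearU _ Uz1) => x; exact: UQ.
apply: (@no_interior_touching R n m n F P Y u z1 xi).
- exact: nz1.
- exact: cD.
- exact: nz1.
- exact: nz1.
- exact: nz1.
- exact: uz1.
- rewrite pderive_sqdist; last exact: tF.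
  by rewrite DxiE -/(G z1) hE mulf_neq0// gt_eqF// dotp_gt0.
apply: filterS (nbhs_lt_cube z1s') => x /ltW xs xz1.
rewrite /sqdist_fun -/(G x) -/(G z1) hE => qx.
have [Ux _] := sP _ (ss _ xs).
rewrite lt_neqAle u0// andbT; apply/eqP => /esym ux.
have Zx : Z x by split=> //=; rewrite ux.
have := z1min x; rewrite inE => /(_ Zx).
rewrite (_ : G z1 - G y = h + h); last by apply/rowP => i; rewrite !mxE; field.
rewrite (_ : G x - G y = (G x - Y) + h); last first.
  by apply/rowP => i; rewrite !mxE; field.
move: qx; move Ea : (G x - Y) => a qx.
rewrite !dotpDl !dotpDr (dotpC h a) => H.
have : dotp (a - h) (a - h) = 0.
  apply/eqP; rewrite eq_le dotp_ge0 andbT !dotpBl !dotpBr (dotpC h a).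
  by move: (dotp a a) (dotp a h) (dotp h h) qx H => p1 p2 p3; lra.
move=> /dotp_eq0 /eqP; rewrite subr_eq0 -Ea -hE => /eqP /addIr Gx.
by move/eqP: xz1; apply; apply: injG => //; exact: ss.
Unshelve. all: by end_near. Qed.

(** * Normal parts and derivatives of frames *)

Section NormalPart.
Context {R : realType} {m n : nat}.
Variable E : 'I_n -> 'rV[R]_m.
Hypothesis oE : forall i j, dotp (E i) (E j) = (i == j)%:R.

Definition frame_span : set 'rV[R]_m := [set w | exists a, w = \sum_i a i *: E i].

(** The formula for [normal_part] on the span of an orthonormal family; unlike
    [normal_part] it is visibly linear. *)
Definition frame_normal (w : 'rV[R]_m) := w - \sum_i dotp w (E i) *: E i.

Lemma normal_part_unique (T : set 'rV[R]_m) (w z : 'rV[R]_m) :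
  (forall a b, T a -> T b -> T (a - b)) ->
  (forall t, T t -> dotp z t = 0) -> T (w - z) -> normal_part T w = z.
Proof.
move=> Tsub zT Twz; apply: xget_unique; first by split.
move=> y [yT Twy]; apply/eqP; rewrite -subr_eq0; apply/eqP/dotp_eq0.
have Tyz : T (y - z).
  by have := Tsub _ _ Twz Twy; rewrite opprB addrC addrA subrK.
by rewrite [LHS]dotpBl yT// zT// subrr.
Qed.

Lemma normal_part_frame_span w : normal_part frame_span w = frame_normal w.
Proof.
apply: normal_part_unique.
- move=> _ _ [a ->] [b ->]; exists (fun i => a i - b i).
  by rewrite -sumrB; apply: eq_bigr => i _; rewrite scalerBl.
- move=> _ [a ->]; rewrite dotp_sumr big1// => i _; rewrite dotpZr.
  rewrite /frame_normal dotpBl dotp_suml (bigD1 i)//= dotpZl oE eqxx mulr1 big1.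
    by rewrite addr0 subrr mulr0.
  by move=> j ji; rewrite dotpZl oE (negbTE ji) mulr0.
- by rewrite /frame_normal opprB addrC subrK; exists (fun i => dotp w (E i)).
Qed.

Lemma frame_normalD w1 w2 : frame_normal (w1 + w2) = frame_normal w1 + frame_normal w2.
Proof.
rewrite /frame_normal; under eq_bigr do rewrite dotpDl scalerDl.
by rewrite big_split/= opprD addrACA.
Qed.

Lemma frame_normalZ a w : frame_normal (a *: w) = a *: frame_normal w.
Proof.
rewrite /frame_normal; under eq_bigr do rewrite dotpZl -scalerA.
by rewrite -scaler_sumr scalerBr.
Qed.

Lemma frame_normal_sum k (w : 'I_k -> 'rV[R]_m) :
  frame_normal (\sum_i w i) = \sum_i frame_normal (w i).
Proof.
apply: (big_ind2 (fun w1 w2 => frame_normal w1 = w2)) => //.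
  by rewrite -(scale0r 0) frame_normalZ !scale0r.
by move=> w1 w1' w2 w2' <- <-; rewrite frame_normalD.
Qed.

Lemma frame_normal_orthogonal w : (forall i, dotp w (E i) = 0) -> frame_normal w = w.
Proof.
by move=> w0; rewrite /frame_normal big1 ?subr0// => i _; rewrite w0 scale0r.
Qed.

End NormalPart.

Section NearEq.
Context {R : realType} {V W : normedModType R}.

(** Differentiability being defined through a choice of the differential, its
    local nature is established first for a function that vanishes near [x]. *)
Lemma differentiable_near0 (f : V -> W) x :
  (\forall y \near x, f y = 0) -> differentiable f x.
Proof.
move=> f0; have nf : \forall y \near (0 : V), f (y + x) = 0.
  have cs : (fun y : V => y + x) @ (0 : V) --> x.
    rewrite -[X in _ --> X]add0r.
    by apply: cvgD; [exact: cvg_id|exact: cvg_cst].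
  exact: cs f0.
have E : f \o shift x = cst (f x) + (\0 : {linear V -> W}) +o_ 0 id.
  apply/eqaddoP => eps eps0; near=> y.
  have fy : f (y + x) = 0 by near: y.
  rewrite !fctE /= fy (nbhs_singleton f0) addr0 subr0 normr0.
  by rewrite mulr_ge0// ltW.
have c0 : continuous (\0 : {linear V -> W}) by exact: cst_continuous.
apply/diff_locallyP; rewrite (diff_unique c0 E); split => //.
Unshelve. all: by end_near. Qed.

Lemma near_eq_differentiable (f g : V -> W) x :
  (\forall y \near x, f y = g y) -> differentiable f x -> differentiable g x.
Proof.
move=> fg df; have -> : g = f + (g - f).
  by apply/funext => y; rewrite !fctE /= addrC subrK.
apply: differentiableD; first exact: df.
apply: differentiable_near0.
by near=> y; rewrite !fctE /= (near fg y)// subrr.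
Unshelve. all: by end_near. Qed.

End NearEq.

Section Smooth.
Context {R : realType} {n m : nat}.
Variables (F : 'rV[R]_n -> 'rV[R]_m) (U : set 'rV[R]_n).
Hypotheses (oU : open U) (sF : smooth_on U F).

Lemma smooth_differentiable x : U x -> differentiable F x.
Proof. exact: (sF 1).1. Qed.

Lemma smooth_derive_differentiable v x : U x -> differentiable ('D_v F) x.
Proof. exact: ((sF 2).2 v).1. Qed.

Lemma smooth_derive_continuous v x : U x -> {for x, continuous ('D_v F)}.
Proof. by move=> Ux; exact/differentiable_continuous/smooth_derive_differentiable. Qed.

Lemma near_pderive_coord_fun v k x : U x ->
  \forall y \near x, coord_fun ('D_v F) k y = pderive v (coord_fun F k) y.
Proof.
move=> Ux; have nU : \forall y \near x, U y by exact: open_nbhs_nbhs.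
near=> y; rewrite pderive_coord_fun//.
by apply: diff_derivable; apply: smooth_differentiable; near: y.
Unshelve. all: by end_near. Qed.

Lemma smooth_twice_differentiable x k : U x -> twice_differentiable (coord_fun F k) x.
Proof.
move=> Ux; split=> [|v w].
  have nU : \forall y \near x, U y by exact: open_nbhs_nbhs.
  near=> y; apply: differentiable_coord_fun; apply: smooth_differentiable.
  by near: y.
apply: (near_eq_derivable (near_pderive_coord_fun v k Ux)).
apply: diff_derivable; apply: differentiable_coord_fun.
exact: smooth_derive_differentiable.
Unshelve. all: by end_near. Qed.

Lemma pderive2_coord_fun v w k x : U x ->
  pderive w (pderive v (coord_fun F k)) x = ('D_w ('D_v F) x) 0 k.
Proof.
move=> Ux; rewrite -(near_eq_pderive w (near_pderive_coord_fun v k Ux)).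
rewrite pderive_coord_fun//.
by apply: diff_derivable; exact: smooth_derive_differentiable.
Qed.

Lemma derive_sum_dir x k (a : 'I_k -> R) (v : 'I_k -> 'rV[R]_n) : U x ->
  'D_(\sum_i a i *: v i) F x = \sum_i a i *: 'D_(v i) F x.
Proof.
move=> /smooth_differentiable dF; rewrite deriveE// linear_sum.
by apply: eq_bigr => i _; rewrite linearZ deriveE.
Qed.

Lemma derive_sub_dir x v w : U x -> 'D_(v - w) F x = 'D_v F x - 'D_w F x.
Proof. by move=> /smooth_differentiable dF; rewrite !deriveE// linearB. Qed.

(** The product rule for [y |-> 'd F y (e y)]. The differential of [push_field]
    is a total function, so the proof also has to establish differentiability,
    through the expansion of [e] in coordinates. *)
Lemma derive_push_field (e : 'rV[R]_n -> 'rV[R]_n) x v : U x ->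
  differentiable e x ->
  'd (push_field F e) x v = 'D_v ('D_(e x) F) x + 'D_('D_v e x) F x.
Proof.
move=> Ux de; have nU : \forall y \near x, U y by exact: open_nbhs_nbhs.
have dd w : differentiable ('D_w F) x by exact: smooth_derive_differentiable.
pose s j k : 'rV[R]_n -> R := coord_fun e j * coord_fun ('D_(delta_mx 0 j) F) k.
have dej j : differentiable (coord_fun e j) x by exact: differentiable_coord_fun.
have ds j k : differentiable (s j k) x.
  apply: differentiableM; first exact: dej.
  by apply: differentiable_coord_fun; exact: dd.
have E k : \forall y \near x, (\sum_j s j k) y = coord_fun (push_field F e) k y.
  near=> y; have Uy : U y by near: y.
  rewrite fct_sumE /coord_fun /push_field -deriveE; last exact: smooth_differentiable.
  rewrite [in RHS](row_sum_delta (e y)) derive_sum_dir// summxE.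
  by apply: eq_bigr => j _; rewrite !mxE.
have dsum k : differentiable (\sum_j s j k) x by exact: differentiable_sum.
have dp : differentiable (push_field F e) x.
  apply: differentiable_row => k; exact: near_eq_differentiable (E k) (dsum k).
apply/rowP => k; rewrite -deriveE// -pderive_coord_fun; last exact: diff_derivable.
rewrite -(near_eq_pderive v (E k)) pderive_sum; last first.
  by move=> j; exact: diff_derivable.
rewrite [in RHS](row_sum_delta (e x)) [in RHS](row_sum_delta ('D_v e x)).
rewrite derive_sum_dir// mxE [X in _ = _ + X]summxE.
have -> : 'D_v ('D_(\sum_j e x 0 j *: delta_mx 0 j) F) x =
    \sum_j e x 0 j *: 'D_v ('D_(delta_mx 0 j) F) x.
  have nE : \forall y \near x, (\sum_j (e x 0 j *: 'D_(delta_mx 0 j) F)) y =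
      'D_(\sum_j e x 0 j *: delta_mx 0 j) F y.
    by near=> y; rewrite fct_sumE derive_sum_dir//; near: y.
  rewrite -(near_eq_derive v nE) derive_sum; last first.
    by move=> j; apply: derivableZ; exact: diff_derivable.
  by apply: eq_bigr => j _; rewrite deriveZ//; exact: diff_derivable.
rewrite summxE -big_split; apply: eq_bigr => j _ /=.
rewrite pderiveM; last 2 first.
- by apply: diff_derivable; exact: dej.
- by apply: diff_derivable; apply: differentiable_coord_fun; exact: dd.
rewrite !pderive_coord_fun; try exact: diff_derivable.
by rewrite !mxE /coord_fun; congr (_ + _); rewrite mulrC.
Unshelve. all: by end_near. Qed.

End Smooth.

(** * Self-shrinkers in charts *)

Section Charts.
Context {R : realType} {n : nat} {M : topologicalType}.
Variable c : chart R n M.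

Lemma chart_inv_continuous_at u : chart_cod c u -> {for u, continuous (chart_inv c)}.
Proof.
move=> cu; have := (@chart_inv_continuous _ _ _ c).
by rewrite (continuous_open_subspace _ (@chart_cod_open _ _ _ c)); apply; rewrite inE.
Qed.

Lemma chart_map_continuous_at p : chart_dom c p -> {for p, continuous (chart_map c)}.
Proof.
move=> cp; have := (@chart_map_continuous _ _ _ c).
by rewrite (continuous_open_subspace _ (@chart_dom_open _ _ _ c)); apply; rewrite inE.
Qed.

End Charts.

Lemma diff_near_comp {R : realType} {U V W : normedModType R}
    (phi : U -> V) (f : V -> W) (g : U -> W) (u v : U) :
  (\forall y \near u, (f \o phi) y = g y) ->
  differentiable phi u -> differentiable f (phi u) -> differentiable g u ->
  'd g u v = 'd f (phi u) ('d phi u v).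
Proof.
move=> fg dphi df dg; rewrite -deriveE// -(near_eq_derive v fg).
have dfphi : differentiable (f \o phi) u by exact: differentiable_comp.
by rewrite (deriveE v dfphi) (diff_comp dphi df).
Qed.

Section Immersion.
Context {R : realType} {n m : nat} {M : smoothManifold R n}.
Variable X : M -> 'rV[R]_m.
Hypothesis iX : immersion X.

(** Another chart factors through [c] by the smooth transition map, so the chain
    rule puts its range inside that of [c]. *)
Lemma tangent_space_chart (c : chart R n M) (p : M) : atlas c -> chart_dom c p ->
  tangent_space X p = range ('d (X \o chart_inv c) (chart_map c p)).
Proof.
move=> ac cp; apply/seteqP; split=> [w|w rw]; last by exists c.
move=> [d [ad dp [v _ <-]]].
pose u := chart_map d p; pose phi := chart_map c \o chart_inv d.
have du : chart_cod d u by exact: chart_map_cod.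
have pu : chart_inv d u = p by exact: chart_mapK.
have dphi : differentiable phi u.
  by apply: (smooth_differentiable (atlas_compatible ad ac)); split => //=; rewrite pu.
have phiu : phi u = chart_map c p by rewrite /phi /= pu.
have near_F : \forall y \near u,
    ((X \o chart_inv c) \o phi) y = (X \o chart_inv d) y.
  have : \forall y \near u, chart_dom c (chart_inv d y).
    apply: (chart_inv_continuous_at du).
    by apply: open_nbhs_nbhs; split; [exact: chart_dom_open|rewrite pu].
  by apply: filterS => y cy; rewrite /phi /= chart_mapK.
have dFd : differentiable (X \o chart_inv d) u.
  exact: smooth_differentiable (iX ad).1 _ du.
have dFc : differentiable (X \o chart_inv c) (phi u).
  rewrite phiu; apply: smooth_differentiable (iX ac).1 _ _; exact: chart_map_cod.
exists ('d phi u v) => //.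
have E := diff_near_comp v near_F dphi dFc dFd.
by rewrite phiu in E; exact: (esym E).
Qed.

Lemma mean_curvature_frame (c : chart R n M) (p : M) P h :
  atlas c -> chart_dom c p -> mean_curvature_wrt P X p h ->
  let F := X \o chart_inv c in let u := chart_map c p in
  exists (W : set 'rV[R]_n) (e : 'I_n -> 'rV[R]_n -> 'rV[R]_n),
    [/\ open W, W u, W `<=` chart_cod c, orthonormal_frame F W e &
     let E := fun i => 'D_(e i u) F u in
     let w := fun i => 'D_(e i u) ('D_(e i u) F) u + 'D_('D_(e i u) (e i) u) F u in
     [/\ forall i j, dotp (E i) (E j) = (i == j)%:R,
         tangent_space X p = frame_span E,
         forall i, 'd (push_field F (e i)) u (e i u) = w i &
         h = \sum_i frame_normal E (P (w i))]].
Proof.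
move=> ac cp mc F u; have [W [e [oW Wu Wc oe hE]]] := mc c ac cp.
exists W, e; split => // E w.
have cu : chart_cod c u by exact: Wc.
have dF : differentiable F u by exact: smooth_differentiable (iX ac).1 _ cu.
have oE i j : dotp (E i) (E j) = (i == j)%:R.
  by rewrite -(oe.2 u Wu i j) /E /push_field !deriveE.
have TE : tangent_space X p = frame_span E.
  rewrite (tangent_space_chart ac cp); apply/seteqP; split=> [_ [v _ <-]|_ [a ->]].
    have [a [-> _]] := orthonormal_frame_basis dF oE v.
    exists a; rewrite -deriveE//; exact: derive_sum_dir (iX ac).1 _ _ _ _ cu.
  exists (\sum_i a i *: e i u) => //; rewrite -deriveE//.
  exact: derive_sum_dir (iX ac).1 _ _ _ _ cu.
have wE i : 'd (push_field F (e i)) u (e i u) = w i.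
  apply: (derive_push_field (@chart_cod_open _ _ _ c) (iX ac).1) => //.
  exact: smooth_differentiable (oe.1 i) _ Wu.
split=> //; rewrite hE; apply: eq_bigr => i _.
by rewrite TE (normal_part_frame_span oE) -wE.
Qed.

(** The normal part of [sum_i w i + X / 2] vanishes, where [w i] is the derivative
    of the frame field [E i] along itself; so this vector is tangent, that is, the
    image of some combination of the [e i]. Moving the first-order terms of [w i]
    to the other side gives [b]. *)
Lemma exists_adapted (c : chart R n M) (x : 'rV[R]_n) :
  self_shrinker X -> atlas c -> chart_cod c x ->
  exists e b, adapted (X \o chart_inv c) x e b.
Proof.
move=> shr ac cx; set F := X \o chart_inv c.
have dp : chart_dom c (chart_inv c x) by exact: chart_inv_dom.
have := mean_curvature_frame ac dp (shr _); rewrite /= chart_invK// -/F.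
move=> [W [e [oW Wx Wc oe [oE TE _ hE]]]].
pose E i := 'D_(e i x) F x; pose d i := 'D_(e i x) (e i) x.
pose w i := 'D_(e i x) ('D_(e i x) F) x + 'D_(d i) F x.
have NE : frame_normal E (\sum_i w i) = - 2^-1 *: frame_normal E (F x).
  by rewrite frame_normal_sum -(normal_part_frame_span oE) -TE.
have : frame_normal E (\sum_i w i + 2^-1 *: F x) = 0.
  by rewrite frame_normalD frame_normalZ NE -scalerDl addNr scale0r.
set S := \sum_i w i + _ => /eqP; rewrite subr_eq0 => /eqP SE.
exists (e^~ x), (\sum_i dotp S (E i) *: e i x - \sum_i 1 *: d i).
have sF := (iX ac).1; have oc := @chart_cod_open _ _ _ c.
split=> [//|k]; rewrite /drift_laplacian.
rewrite (eq_bigr _ (fun i _ => pderive2_coord_fun oc sF (e i x) (e i x) k cx)).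
have dF : differentiable F x by exact: smooth_differentiable sF _ cx.
rewrite pderive_coord_fun; last exact: diff_derivable.
have -> : 'D_(\sum_i dotp S (E i) *: e i x - \sum_i 1 *: d i) F x =
    S - \sum_i 'D_(d i) F x.
  rewrite (derive_sub_dir sF _ _ cx) !(derive_sum_dir sF _ _ cx) -SE.
  by congr (_ - _); apply: eq_bigr => i _; rewrite scale1r.
have -> : \sum_i ('D_(e i x) ('D_(e i x) F) x) 0 k =
    (\sum_i w i - \sum_i 'D_(d i) F x) 0 k.
  rewrite -sumrB summxE; apply: eq_bigr => i _.
  by rewrite /w addrK.
by rewrite /S !mxE; ring.
Qed.

End Immersion.

(** * The distance to the sphere is constant *)

Section SphereDefect.
Context {R : realType} {V : normedModType R} {m : nat}.
Variables (F : V -> 'rV[R]_m) (r2 s : R).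

Definition sphere_defect : V -> R :=
  cst s * (sqdist_fun F 1%:M 0 + cst (- r2)).

Lemma sphere_defectE x : sphere_defect x = s * (dotp (F x) (F x) - r2).
Proof. by rewrite /sphere_defect !fctE /= /sqdist_fun mulmx1 subr0. Qed.

Lemma twice_differentiable_sphere_defect x :
  (forall k, twice_differentiable (coord_fun F k) x) ->
  twice_differentiable sphere_defect x.
Proof.
move=> tF; have tc c := twice_differentiable_cst c x.
exact (twice_differentiableM (tc s)
  (twice_differentiableD (twice_differentiable_sqdist 1%:M 0 tF) (tc _))).
Qed.

End SphereDefect.

(** [L |F|^2 = 2 sum_i |D_(e i) F|^2 - |F|^2], and the frame has [n] unit vectors. *)
Lemma drift_laplacian_sphere_defect {R : realType} {n m : nat}
    (F : 'rV[R]_n -> 'rV[R]_m) (s : R) x e b :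
  (forall k, twice_differentiable (coord_fun F k) x) -> adapted F x e b ->
  drift_laplacian e b (sphere_defect F (2 * n%:R) s) x =
  - sphere_defect F (2 * n%:R) s x.
Proof.
move=> tF [oe LF]; have tc c := twice_differentiable_cst c x.
have tq := twice_differentiable_sqdist 1%:M 0 tF.
rewrite (drift_laplacianZ e b s (twice_differentiableD tq (tc _))).
rewrite (drift_laplacianD e b tq (tc _)) drift_laplacian_cst addr0.
rewrite (drift_laplacian_sqdist _ _ tF LF) sphere_defectE !mulmx1 subr0.
have -> : \sum_i dotp ('D_(e i) F x *m 1%:M) ('D_(e i) F x *m 1%:M) = n%:R.
  rewrite -[n in RHS]card_ord -sumr_const; apply: eq_bigr => i _.
  by rewrite mulmx1 oe eqxx.
ring.
Qed.

Section Shrinker.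
Context {R : realType} {n m : nat} {M : smoothManifold R n}.
Variable X : M -> 'rV[R]_m.
Hypotheses (iX : immersion X) (cX : continuous X) (shr : self_shrinker X).

Lemma local_min_chart (c : chart R n M) (p : M) (g : M -> R) : chart_dom c p ->
  (\forall q \near p, g p <= g q) ->
  \forall y \near chart_map c p,
    g (chart_inv c (chart_map c p)) <= g (chart_inv c y).
Proof.
move=> cp gp; rewrite chart_mapK//.
have cinv := chart_inv_continuous_at (chart_map_cod cp).
have {}cinv : chart_inv c @ chart_map c p --> p.
  by rewrite -[X in _ --> X](chart_mapK cp).
exact: cinv gp.
Qed.

(** The sign [s] covers both sides of the sphere: [1] outside, [-1] inside. *)
Section Defect.
Variable s : R.
Let u (p : M) : R := s * (dotp (X p) (X p) - 2 * n%:R).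
Hypothesis u_ge0 : forall p, 0 <= u p.
Hypothesis compact_sublevel : forall a, compact [set p | u p <= a].

Let continuous_u : continuous u.
Proof.
move=> p; have cXX := continuous_dotp (@cX p) (@cX p).
apply: (@continuousM R M (cst s) (fun q => dotp (X q) (X q) - 2 * n%:R)).
  exact: cst_continuous.
by apply: continuousB; [exact: cXX|exact: cst_continuous].
Qed.

Let uE (c : chart R n M) : u \o chart_inv c =
  sphere_defect (X \o chart_inv c) (2 * n%:R) s.
Proof. by apply/funext => y; rewrite sphere_defectE. Qed.

Lemma defect_eq0_open p : u p = 0 -> \forall q \near p, u q = 0.
Proof.
move=> up; have [c ac cp] := atlas_cover p.
have sF := (iX ac).1; have oc := @chart_cod_open _ _ _ c.
set F := X \o chart_inv c in sF.
have cx : chart_cod c (chart_map c p) by exact: chart_map_cod.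
have tF x : chart_cod c x -> forall j, twice_differentiable (coord_fun F j) x.
  by move=> cx' j; exact: (smooth_twice_differentiable oc sF).
have near_u : \forall y \near chart_map c p, (u \o chart_inv c) y = 0.
  apply: (@strong_minimum_principle _ _ _ F _ (chart_cod c)) => //.
  - by move=> x cx' v; exact: (smooth_derive_continuous sF).
  - exact: (iX ac).2.
  - by move=> x cx'; rewrite uE; apply: twice_differentiable_sphere_defect; exact: tF.
  - by move=> x _; exact: u_ge0.
  - move=> x cx'; have [e [b eF]] := exists_adapted iX shr ac cx'.
    exists e, b; split => //.
    rewrite uE (drift_laplacian_sphere_defect s (tF _ cx') eF) -uE oppr_le0.
    exact: u_ge0.
  - by rewrite /= chart_mapK.
have np : \forall q \near p, chart_dom c q.
  by apply: open_nbhs_nbhs; split => //; exact: chart_dom_open.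
have nq : \forall q \near p, u (chart_inv c (chart_map c q)) = 0.
  exact: (@chart_map_continuous_at _ _ _ c p cp _ near_u).
near=> q; have cq : chart_dom c q by near: q.
by rewrite -(chart_mapK cq); near: q.
Unshelve. all: by end_near. Qed.

Lemma defect_local_min p : (\forall q \near p, u p <= u q) -> u p <= 0.
Proof.
move=> umin; have [c ac cp] := atlas_cover p.
have sF := (iX ac).1; have oc := @chart_cod_open _ _ _ c.
have cx : chart_cod c (chart_map c p) by exact: chart_map_cod.
have [e [b eF]] := exists_adapted iX shr ac cx.
have tF j := smooth_twice_differentiable oc sF j cx.
have tu : twice_differentiable (u \o chart_inv c) (chart_map c p).
  by rewrite uE; exact: twice_differentiable_sphere_defect.
have := local_min_drift_laplacian_ge0 e b tu (local_min_chart cp umin).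
by rewrite uE drift_laplacian_sphere_defect// -uE /= chart_mapK// oppr_ge0.
Qed.

(** A smallest positive value of [u] would be attained at a local minimum, since
    [u] has no zero nearby; [defect_local_min] forbids it. *)
Lemma defect_eq0 p : u p = 0.
Proof.
apply: contrapT => up.
pose Z := [set q | u q != 0].
have oZ : open (~` Z).
  rewrite openE => q /= /negP/negPn/eqP uq.
  apply: filterS (defect_eq0_open uq) => t ut.
  by apply/negP/negPn/eqP.
have cZ : closed Z by rewrite -[Z]setCK; exact: open_closedC.
pose K := Z `&` u @^-1` [set t | t <= u p].
have Kp : K p by split => //=; exact/eqP.
have cK : compact K.
  apply: (@subclosed_compact _ _ [set q | u q <= u p]) => [||q []//];
    last exact: compact_sublevel.
  apply: closed_setI_preimage; [exact: cZ| |exact: closed_le].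
  by move=> q _; exact: continuous_u.
have [|q + qmin] := compact_EVT_min (ex_intro _ p Kp) cK (f := u).
  by apply: continuous_in_subspaceT => q _; exact: continuous_u.
rewrite inE => -[/= uq0 uqp].
have uq : 0 < u q by rewrite lt_neqAle eq_sym uq0 u_ge0.
suff : u q <= 0 by rewrite leNgt uq.
apply: defect_local_min.
have /cvgr_gt /(_ _ uq) := @continuous_u q.
apply: filterS => t ut; have [utp|/ltW] := leP (u t) (u p); last exact: le_trans.
by apply: qmin; rewrite inE; split => //; rewrite /Z /= gt_eqF.
Qed.

End Defect.
End Shrinker.

(** * Balls, spheres and hyperplanes *)

Section EuclideanBalls.
Context {R : realType} {m : nat}.

Lemma dotp_continuous : continuous (fun x : 'rV[R]_m => dotp x x).
Proof. by move=> x; apply: continuous_dotp; exact: cvg_id. Qed.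

Lemma compact_dotp_le (a : R) : compact [set x : 'rV[R]_m | dotp x x <= a].
Proof.
have [a0|a0] := ltP a 0.
  rewrite (_ : mkset _ = set0); first exact: compact0.
  apply/seteqP; split=> // x /= xa; have := dotp_ge0 x.
  by rewrite leNgt (le_lt_trans xa).
apply: (@subclosed_compact _ _ (cube (0 : 'rV[R]_m) (1 + a))); last 2 first.
- exact: compact_cube.
- move=> x /= xa; rewrite /cube /= subr0.
  have := normr_sqr_le_dotp x; have := normr_ge0 x; nra.
have := @closed_setI_preimage 'rV[R]_m R setT [set t | t <= a]
  (fun x => dotp x x) closedT.
rewrite setTI; apply; last exact: closed_le.
by move=> x _; exact: dotp_continuous.
Qed.

Lemma closure_eexterior_dotp_ge (b : R) : 0 <= b ->
  closure (eexterior m (Num.sqrt b)) `<=` [set x | b <= dotp x x].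
Proof.
move=> b0; have cC : closed [set x : 'rV[R]_m | b <= dotp x x].
  have := @closed_setI_preimage 'rV[R]_m R setT [set t | b <= t]
    (fun x => dotp x x) closedT.
  rewrite setTI; apply; last exact: closed_ge.
  by move=> x _; exact: dotp_continuous.
move=> x clx; apply: cC; apply: closure_subset clx => y yext.
rewrite /= leNgt; apply/negP => yb; apply: yext; apply: subset_closure.
by rewrite /eball /= /enorm ltr_sqrt// (le_lt_trans (dotp_ge0 y) yb).
Qed.

Lemma closure_eball_dotp_le (b : R) :
  closure (eball m (Num.sqrt b)) `<=` [set x | dotp x x <= b].
Proof.
have cC : closed [set x : 'rV[R]_m | dotp x x <= b].
  by apply: compact_closed; [exact: norm_hausdorff|exact: compact_dotp_le].
move=> x clx; apply: cC; apply: closure_subset clx => y.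
rewrite /eball /= /enorm => yb; apply: ltW; rewrite -ltr_sqrt//.
by rewrite -sqrtr_gt0; apply: le_lt_trans yb; exact: sqrtr_ge0.
Qed.

Lemma esphere_dotp (b : R) (x : 'rV[R]_m) : 0 <= b ->
  esphere m (Num.sqrt b) x <-> dotp x x = b.
Proof.
move=> b0; rewrite /esphere /= /enorm; split=> [/eqP|->//].
by rewrite eqr_sqrt ?dotp_ge0// => /eqP.
Qed.

Lemma tangent_part_sphere (x w : 'rV[R]_m) : x != 0 ->
  tangent_part (sphere_tangent x) w = w - (dotp w x / dotp x x) *: x.
Proof.
move=> x0; congr (_ - _); apply: normal_part_unique.
- by move=> a b; rewrite /sphere_tangent /= dotpBl => -> ->; rewrite subr0.
- by move=> t; rewrite /sphere_tangent /= dotpZl dotpC => ->; rewrite mulr0.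
- rewrite /sphere_tangent /= dotpBl dotpZl divfK ?subrr//.
  by rewrite gt_eqF// dotp_gt0.
Qed.

(** Both vectors lie in the kernel of [A^T], with [A] the matrix of the [E i],
    which has rank [1]. *)
Lemma orthogonal_complement_line (n : nat) (E : 'I_n -> 'rV[R]_m) (x y : 'rV[R]_m) :
  m = n.+1 -> (forall i j, dotp (E i) (E j) = (i == j)%:R) ->
  (forall i, dotp (E i) x = 0) -> (forall i, dotp (E i) y = 0) -> x != 0 ->
  exists a, y = a *: x.
Proof.
move=> mn oE Ex Ey x0; pose A := \matrix_i E i.
have EA i : row i A = E i by rewrite rowK.
have rA : \rank A = n.
  apply/eqP; apply/row_freeP; exists A^T; apply/matrixP => i j.
  by rewrite !mxE -oE; apply: eq_bigr => k _; rewrite !mxE.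
have inK z : (forall i, dotp (E i) z = 0) -> (z <= kermx A^T)%MS.
  move=> Ez; apply/sub_kermxP; apply/rowP => i; rewrite !mxE -[RHS](Ez i).
  by apply: eq_bigr => k _; rewrite !mxE mulrC.
have rK : \rank (kermx A^T) = 1%N by rewrite mxrank_ker mxrank_tr rA mn subSnn.
have xK : (x :=: kermx A^T)%MS.
  by apply/eqmxP; rewrite -(geq_leqif (mxrank_leqif_eq (inK _ Ex))) rK rank_rV x0.
by apply/sub_rVP; rewrite xK inK.
Qed.

End EuclideanBalls.

(** * Self-shrinkers contained in the sphere *)

Section ShrinkerOnSphere.
Context {R : realType} {n m : nat} {M : smoothManifold R n}.
Variable X : M -> 'rV[R]_m.
Hypotheses (iX : immersion X) (shr : self_shrinker X).
Hypothesis XS : forall p, dotp (X p) (X p) = 2 * n%:R.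

(** The derivative of the constant function [|F|^2]. *)
Lemma position_orthogonal (c : chart R n M) x v : atlas c -> chart_cod c x ->
  dotp ('D_v (X \o chart_inv c) x) (X (chart_inv c x)) = 0.
Proof.
move=> ac cx; set F := X \o chart_inv c.
have tF k := smooth_twice_differentiable (@chart_cod_open _ _ _ c) (iX ac).1 k cx.
have := pderive_sqdist 1%:M 0 tF v.
rewrite (_ : sqdist_fun _ _ _ = cst (2 * n%:R)).
  rewrite pderive_cst !mulmx1 subr0 -/F dotpC => /esym/eqP.
  by rewrite mulf_eq0 pnatr_eq0 /= => /eqP.
by apply/funext => y; rewrite /sqdist_fun mulmx1 subr0 XS.
Qed.

(** As [X p] is normal, projecting [w i] to the tangent space of the sphere
    subtracts [<w i, X p> / |X p|^2] times [X p] from its normal part. The sum of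
    the normal parts is [- X p / 2] by the shrinker equation, and pairing it with
    [X p] shows that the sum of the subtracted terms is [- X p / 2] too. *)
Lemma shrinker_sphere_minimal p :
  mean_curvature_wrt (tangent_part (sphere_tangent (X p))) X p 0.
Proof.
move=> c ac cp F x; have [W [e [oW Wx Wc oe [oE TE wE hE]]]] :=
  mean_curvature_frame iX ac cp (@shr p).
exists W, e; split=> //; apply/esym.
case: (posnP n) => [n0|n0].
  by apply: big1 => i _; have := ltn_ord i; rewrite {2}n0.
have Fx : F x = X p by rewrite /F /= chart_mapK.
have Xn0 : X p != 0.
  by apply/eqP => X0; have := XS p; rewrite X0 dotp0l => /esym/eqP;
    rewrite mulf_eq0 !pnatr_eq0/= (gtn_eqF n0).
set E := (fun i => 'D_(e i x) F x) in oE TE hE.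
pose w i := 'd (push_field F (e i)) x (e i x).
have EX i : dotp (E i) (X p) = 0.
  by have := position_orthogonal (e i x) ac (chart_map_cod cp); rewrite chart_mapK.
have NX : frame_normal E (X p) = X p.
  by apply: frame_normal_orthogonal => i; rewrite dotpC.
have hE' : - 2^-1 *: X p = \sum_i frame_normal E (w i).
  rewrite -[in LHS]NX -(normal_part_frame_span oE) -TE hE.
  by apply: eq_bigr => i _; rewrite /w wE.
have NwX i : dotp (frame_normal E (w i)) (X p) = dotp (w i) (X p).
  rewrite /frame_normal dotpBl dotp_suml big1 ?subr0// => j _.
  by rewrite dotpZl EX mulr0.
have sumw : \sum_i dotp (w i) (X p) = - n%:R.
  under eq_bigr do rewrite -NwX.
  by rewrite -dotp_suml -hE' dotpZl XS; field.
transitivity (\sum_i (frame_normal E (w i)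
    - (dotp (w i) (X p) / dotp (X p) (X p)) *: X p)).
  apply: eq_bigr => i _; rewrite TE (normal_part_frame_span oE) tangent_part_sphere//.
  by rewrite -scaleNr frame_normalD frame_normalZ NX -/(w i) scaleNr.
rewrite sumrB -hE' -scaler_suml -mulr_suml sumw XS -scalerBl.
rewrite (_ : - 2^-1 - - n%:R / (2 * n%:R) = 0) ?scale0r//.
by field; rewrite pnatr_eq0 -lt0n.
Qed.

(** Minimizing [h] maximizes [<X, s>]. At [p] the vectors [s] and [X p] are both
    orthogonal to the [n] frame vectors, hence proportional, and the drift
    Laplacian of [h] gives the sign of the factor. *)
Lemma shrinker_hypersurface_onto (s : 'rV[R]_m) : continuous X ->
  compact [set: M] -> [set: M] !=set0 -> m = n.+1 -> dotp s s = 2 * n%:R ->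
  exists p, X p = s.
Proof.
move=> cX cM M0 mn ss.
pose h (p : M) := - dotp (X p) s.
have ch : continuous h.
  move=> p; apply: (@continuousN _ _ _ (fun q => dotp (X q) s)).
  by apply: (continuous_dotp (@cX p)); exact: cst_continuous.
have [|p _ hmin] := compact_EVT_min M0 cM (f := h).
  by apply: continuous_in_subspaceT => p _; exact: ch.
have {}hmin : \forall q \near p, h p <= h q by near=> q; apply: hmin; rewrite inE.
exists p; have [c ac cp] := atlas_cover p.
(* the radius is zero when [n = 0] *)
have [n0|n0] := eqVneq (dotp s s) 0.
  have -> : s = 0 by exact: dotp_eq0.
  by apply: dotp_eq0; rewrite XS -ss.
have cx : chart_cod c (chart_map c p) by exact: chart_map_cod.
set F := X \o chart_inv c; set x := chart_map c p in cx.
have [e [b [oE LF]]] := exists_adapted iX shr ac cx; rewrite -/F in oE LF.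
have tF k := smooth_twice_differentiable (@chart_cod_open _ _ _ c) (iX ac).1 k cx.
(* [P] makes [h] an affine function of [X] *)
pose P : 'M[R]_(m, 1) := \matrix_(i, _) - s 0 i.
have PE (y : 'rV[R]_m) : (y *m P) 0 0 = - dotp y s.
  by rewrite mxE -sumrN; apply: eq_bigr => i _; rewrite mxE mulrN.
have hE : h \o chart_inv c = affine_fun F P 0 0.
  by apply/funext => y; rewrite affine_funE subr0 PE.
have ta := twice_differentiable_affine P 0 tF 0.
have hmin' : \forall y \near x, affine_fun F P 0 0 x <= affine_fun F P 0 0 y.
  by rewrite -hE; exact: local_min_chart.
have Es i : dotp ('D_(e i) F x) s = 0.
  have [+ _] := local_min_second_derivative_ge0 (e i) ta hmin'.
  by rewrite pderive_affine// PE => /eqP; rewrite oppr_eq0 => /eqP.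
have Fx : F x = X p by rewrite /F /= chart_mapK.
have Xs : 0 <= dotp (X p) s.
  have := local_min_drift_laplacian_ge0 e b ta hmin'.
  rewrite (drift_laplacian_affine P 0 tF 0 LF) PE -Fx; lra.
have EX i : dotp ('D_(e i) F x) (X p) = 0.
  by rewrite -Fx; exact: position_orthogonal.
have Xn0 : X p != 0.
  by apply: contra_neq n0 => X0; rewrite ss -(XS p) X0 dotp0l.
have [a sE] := orthogonal_complement_line mn oE EX Es Xn0.
have XX : 0 < dotp (X p) (X p) by exact: dotp_gt0.
have a1 : a = 1.
  move: Xs ss; rewrite sE dotpZr dotpZl dotpZr -(XS p).
  rewrite pmulr_lge0// => a0 /eqP; rewrite mulrA -subr_eq0.
  rewrite -[X in _ - X]mul1r -mulrBl mulf_eq0 (gt_eqF XX) orbF.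
  by rewrite subr_eq0 -expr2 sqrp_eq1// => /eqP.
by rewrite sE a1 scale1r.
Unshelve. all: by end_near. Qed.

End ShrinkerOnSphere.

Theorem theorem10 (R : realType) (n m : nat) (M : smoothManifold R n)
    (X : M -> 'rV[R]_m) :
  let r : R := Num.sqrt (2 * n%:R) in
  (n < m)%N ->
  [set: M] !=set0 ->
  immersion X ->
  proper_map X ->
  complete_immersion X ->
  self_shrinker X ->
  range X `<=` closure (eexterior m r) \/ range X `<=` closure (eball m r) ->
  [/\ compact [set: M],
      range X `<=` esphere m r,
      minimal_in_sphere r X &
      n = m.-1 -> range X = esphere m r].
Proof.
move=> r nm M0 iX [cX pX] _ shr side.
have b0 : 0 <= 2 * n%:R :> R by rewrite mulr_ge0.
have compact_ball a : compact [set p | dotp (X p) (X p) <= a].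
  exact: (pX _ (@compact_dotp_le R m a)).
have XS p : dotp (X p) (X p) = 2 * n%:R.
  suff [s s0 u0] : exists2 s : R, s != 0 & s * (dotp (X p) (X p) - 2 * n%:R) = 0.
    by move/eqP: u0; rewrite mulf_eq0 (negbTE s0) subr_eq0 => /eqP.
  case: side => side; [exists 1; first exact: oner_neq0
                      |exists (- 1); first by rewrite oppr_eq0 oner_neq0].
  - apply: (@defect_eq0 _ _ _ _ X iX cX shr 1) => [q|a].
      rewrite mul1r subr_ge0; apply: (closure_eexterior_dotp_ge b0).
      by apply: side; exists q.
    rewrite (_ : mkset _ = [set q | dotp (X q) (X q) <= a + 2 * n%:R]).
      exact: compact_ball.
    by apply/seteqP; split=> q /=; rewrite mul1r lerBlDr.
  - have inside q : dotp (X q) (X q) <= 2 * n%:R.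
      by apply: closure_eball_dotp_le; apply: side; exists q.
    apply: (@defect_eq0 _ _ _ _ X iX cX shr (- 1)) => [q|a].
      by rewrite mulN1r oppr_ge0 subr_le0.
    rewrite (_ : mkset _ = [set q | dotp (X q) (X q) <= 2 * n%:R] `&`
       (fun q => dotp (X q) (X q)) @^-1` [set t | 2 * n%:R - a <= t]).
      apply: (@subclosed_compact _ _ [set q | dotp (X q) (X q) <= 2 * n%:R]).
      - apply: closed_setI_preimage; last exact: closed_ge.
          rewrite (_ : mkset _ = [set: M]); first exact: closedT.
          by apply/seteqP; split=> q //= _; exact: inside.
        by move=> q _; exact: (continuous_dotp (@cX q) (@cX q)).
      - exact: compact_ball.
      - by move=> q [].
    apply/seteqP; split=> q /=; rewrite mulN1r opprB.
      by move=> qa; split; [exact: inside|lra].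
    by move=> [_ qa]; lra.
have cM : compact [set: M].
  rewrite (_ : [set: M] = [set p | dotp (X p) (X p) <= 2 * n%:R]).
    exact: compact_ball.
  by apply/seteqP; split=> q //= _; rewrite XS.
have XSr : range X `<=` esphere m r.
  by move=> _ [p _ <-]; apply/esphere_dotp.
split=> // [|nE].
  by split=> // p; exact: shrinker_sphere_minimal.
apply/seteqP; split=> // s /(esphere_dotp _ b0) ss.
have mn : m = n.+1 by rewrite nE prednK// (leq_ltn_trans _ nm).
have [p <-] := shrinker_hypersurface_onto iX shr XS cX cM M0 mn ss.
by exists p.
Qed.
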